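(* Let $j>0$ and let $\rho_{\rm init}\in\mathcal M$, i.e. $\rho_{\rm init}=\rho^{(M)}$ for some $M\ge 0$. Then the hydrodynamic limit $\rho_t$ started from $\rho_{\rm init}$ satisfies $\rho_t=\rho_{\rm init}$ for all $t\ge 0$.
   Context: Particle system: fix $j>0$. For $\varepsilon>0$ with $\varepsilon^{-1}$ a positive integer let $\Lambda_\varepsilon=\{0,1,\dots,\varepsilon^{-1}\}$; configurations are $\xi\in\mathbb N^{\Lambda_\varepsilon}$, $\xi(x)$ being the number of particles at $x$. The process $(\xi_t)_{t\ge0}$ is the Markov jump process with generator $L=L^0+L_b+L_a$, where $L^0f(\xi)=\frac12\sum_{x=0}^{\varepsilon^{-1}-1}[\xi(x)(f(\xi^{x,x+1})-f(\xi))+\xi(x+1)(f(\xi^{x+1,x})-f(\xi))]$ ($\xi^{x,y}$ is obtained by moving one particle from $x$ to $y$), $L_bf(\xi)=j\varepsilon(f(\xi^+)-f(\xi))$ with $\xi^+(x)=\xi(x)+\mathbf 1_{x=0}$, and $L_af(\xi)=j\varepsilon(f(\xi^-)-f(\xi))$ with $\xi^-(x)=\xi(x)-\mathbf 1_{x=R_\xi}$, $R_\xi=\max\{y:\xi(y)>0\}$ ($L_af=0$ if $\xi\equiv0$). $P^{(\varepsilon)}_\xi$ denotes the law of the process started from $\xi$. Notation: $F(r;u)=\int_r^1u(r')dr'$ for $r\in[0,1]$, and $F_\varepsilon(x;\xi)=\sum_{y\ge x}\xi(y)$. For an integer $\ell$ and $x\in[0,\varepsilon^{-1}-\ell+1]$: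 $\mathcal A_\ell(x,\xi)=\frac1\ell\sum_{y=x}^{x+\ell-1}\xi(y)$, $\mathcal A'_\ell(x,\rho)=\frac1{\varepsilon\ell}\int_{\varepsilon x}^{\varepsilon(x+\ell)}\rho(r)dr$. Admissible initial data: $\rho_{\rm init}\in C([0,1],\mathbb R_+)$; its edge (if it exists) is $R(0)=\min\{r:\rho_{\rm init}(r')=0\ \forall r'\in[r,1]\}$. Fix $b<1$ close to $1$ and $a>0$ small, $\ell=\lfloor\varepsilon^{-b}\rfloor$. A family of configurations $\xi=\xi^{(\varepsilon)}$ approximates $\rho_{\rm init}$ if $\max_{x\in[0,\varepsilon^{-1}-\ell+1]}|\mathcal A_\ell(x,\xi)-\mathcal A'_\ell(x,\rho_{\rm init})|\le\varepsilon^a$ and, when $\rho_{\rm init}$ has an edge, $|\varepsilon R_\xi-R(0)|\le\varepsilon^a$. Hydrodynamic limit (known from earlier work): for such $\rho_{\rm init}$ there is a function $\rho_t(r)\ge0$, continuous in $(t,r)$, with $\rho_0=\rho_{\rm init}$, such that for every approximating family $\xi$, every $T>0$, $\zeta>0$, $t\in[0,T]$: $\lim_{\varepsilon\to0}P^{(\varepsilon)}_\xi[\max_{x\in[0,\varepsilon^{-1}]}|\varepsilon F_\varepsilon(x;\xi_{\varepsilon^{-2}t})-F(\varepsilon x;\rho_t)|\le\zeta]=1$. This $\rho_t$ is ''the hydrodynamic limit started from $\rho_{\rm init}$''. Linear profiles: $\mathcal M=\{\rho^{(M)}:M\ge0\}$ where $\rho^{(0)}\equiv0$; for $0<M<j$,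 $\rho^{(M)}(r)=2j(R-r)\mathbf 1_{r\le R}$ with $R\in(0,1)$ chosen so that $\int_0^1\rho^{(M)}=M$ (i.e. $jR^2=M$); for $M\ge j$, $\rho^{(M)}(r)=-2jr+c$ with $c\ge2j$ chosen so that $\int_0^1\rho^{(M)}=M$ (i.e. $c=M+j$). *)

(* Defs.v *)
From HB Require Import structures.
From mathcomp Require Import all_boot all_order all_algebra.
From mathcomp Require Import all_classical all_reals all_analysis.
Set Implicit Arguments. Unset Strict Implicit. Unset Printing Implicit Defensive.
Import Order.TTheory GRing.Theory Num.Theory.
Import numFieldNormedType.Exports.
Local Open Scope classical_set_scope.
Local Open Scope ring_scope.

Section Defs.
Variable R : realType.

(* eps^{-1} = N (N >= 1); Lambda_eps = {0,...,N} = 'I_N.+1;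
   a configuration is a finite function Lambda_eps -> nat *)
Definition conf (N : nat) := {ffun 'I_N.+1 -> nat}.

Definition cmove N (xi : conf N) (x y : 'I_N.+1) : conf N :=
  [ffun z => (xi z - (z == x) + (z == y))%N].
Definition cplus N (xi : conf N) : conf N :=
  [ffun z => (xi z + (z == ord0))%N].
(* R_xi = max {y : xi(y) > 0}  (0 when xi == 0; irrelevant then since rate 0) *)
Definition redge N (xi : conf N) : nat := (\max_(y < N.+1 | 0 < xi (inord y)) y)%N.
Definition cminus N (xi : conf N) : conf N :=
  [ffun z => (xi z - (val z == redge xi))%N].

(* the jumps of the generator L = L^0 + L_b + L_a from xi, as (rate, target) *)
Definition jumps (j : R) N (xi : conf N) : seq (R * conf N) :=
  flatten [seq [:: ((xi (inord i))%:R / 2, cmove xi (inord i) (inord i.+1));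
                   ((xi (inord i.+1))%:R / 2, cmove xi (inord i.+1) (inord i))]
          | i <- iota 0 N]
  ++ [:: (j / N%:R, cplus xi);
         ((if xi == [ffun=> 0%N] then 0 else j / N%:R), cminus xi)].

Definition qrate (j : R) N (xi : conf N) : R := \sum_(p <- jumps j xi) p.1.

(* Feller's iteration for the minimal solution of the backward Kolmogorov
   equation: pn n t xi eta = P_xi(X_t = eta, at most n jumps by time t). *)
Fixpoint pn (j : R) N (n : nat) (t : R) (xi eta : conf N) {struct n} : R :=
  match n with
  | 0 => (xi == eta)%:R * expR (- qrate j xi * t)
  | n'.+1 => (xi == eta)%:R * expR (- qrate j xi * t) +
      \int[lebesgue_measure]_(s in `[0, t]%classic)
         (expR (- qrate j xi * s) *
          \sum_(p <- jumps j xi) p.1 * pn j n' (t - s) p.2 eta)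
  end.

(* transition function p_t(xi, eta) of the (non-explosive) Markov jump process *)
Definition ptrans (j : R) N (t : R) (xi eta : conf N) : R :=
  limn (fun n => pn j n t xi eta).

Definition probat (j : R) N (xi : conf N) (t : R) (A : set (conf N)) : \bar R :=
  esum A (fun eta => (ptrans j t xi eta)%:E).

Definition Fc (r : R) (u : R -> R) : R :=
  \int[lebesgue_measure]_(s in `[r, 1]%classic) u s.
Definition Fd N (x : 'I_N.+1) (xi : conf N) : nat :=
  (\sum_(y < N.+1 | (x <= y)%N) xi (inord y))%N.

Definition ell (b : R) (N : nat) : nat := Num.truncn ((N%:R : R) `^ b).
Definition Ad (l : nat) N (x : nat) (xi : conf N) : R :=
  (l%:R)^-1 * (\sum_(x <= y < x + l) (xi (inord y))%:R).
(* A'_ell(x, rho): rho is taken to be 0 outside [0,1] *)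
Definition Ac (l : nat) N (x : nat) (rho : R -> R) : R :=
  (N%:R / l%:R) *
  \int[lebesgue_measure]_(s in (`[x%:R / N%:R, (x + l)%:R / N%:R] `&` `[0, 1])%classic)
     rho s.

Definition edge_set (rho : R -> R) : set R :=
  [set r | 0 <= r <= 1 /\ forall r', r <= r' <= 1 -> rho r' = 0].
Definition is_edge (rho : R -> R) (r : R) : Prop :=
  edge_set rho r /\ forall r', edge_set rho r' -> r <= r'.

Definition admissible (rho : R -> R) : Prop :=
  {within `[0, 1]%classic, continuous rho} /\ forall r, 0 <= r <= 1 -> 0 <= rho r.

Definition approximates (a b : R) (rho : R -> R) (xi : forall N, conf N) : Prop :=
  forall N : nat, (0 < N)%N ->
    (forall x : nat, (x + ell b N <= N.+1)%N ->
       `|Ad (ell b N) x (xi N) - Ac (ell b N) N x rho| <= (N%:R : R)^-1 `^ a) /\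
    (forall r, is_edge rho r ->
       `|(redge (xi N))%:R / N%:R - r| <= (N%:R : R)^-1 `^ a).

Definition hydro_limit (j a b : R) (rho0 : R -> R) (rho : R -> R -> R) : Prop :=
  {within [set p : R * R | 0 <= p.1 /\ 0 <= p.2 <= 1],
     continuous (fun p : R * R => rho p.1 p.2)} /\
  (forall t r, 0 <= t -> 0 <= r <= 1 -> 0 <= rho t r) /\
  (forall r, 0 <= r <= 1 -> rho 0 r = rho0 r) /\
  forall xi : forall N, conf N, approximates a b rho0 xi ->
  forall T zeta t : R, 0 < zeta -> 0 <= t <= T ->
    (fun N : nat =>
       probat j (xi N) ((N%:R) ^+ 2 * t)
         [set eta | forall x : 'I_N.+1,
            `|(N%:R)^-1 * (Fd x eta)%:R - Fc (x%:R / N%:R) (rho t)| <= zeta])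
    @ \oo --> 1%E.

Definition rhoM (j M : R) (r : R) : R :=
  if M == 0 then 0
  else if M < j then
    (let Rr := Num.sqrt (M / j) in if r <= Rr then 2 * j * (Rr - r) else 0)
  else - 2 * j * r + (M + j).

End Defs.

(* Main.v *)
(** With [N] the inverse of epsilon, let [F x] be the number of particles at or to the right of
    [x]. Its drift is [(1/2) Laplacian F - (j/N) 1_{F > 0}], an obstacle-type equation whose
    reaction term is monotone, hence an L2 contraction. The linear profile has an exact discrete
    stationary counterpart [G] with [(1/2) Laplacian G = (j/N) 1_{x < c}]. Put
    [h = F - G - m lin], where [m] is the excess mass and [lin] is linear, so that [h]
    vanishes at both ends, and let [P] be the Dirichlet kernel with weights 1/4, 1/2, 1/4.
    The functional [Phi = |P^k h|^2] is used instead of [|h|^2] because particle noise enters at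
    rate [N P^{2k}(x,x)], which is [N] times a quantity tending to 0 with [k], while the price paid
    for smoothing in the monotonicity argument is only [O(k)]. Over times of order [N^2] this
    keeps [Phi + N m^2] negligible with respect to [N^3], and since [F] is monotone and [G]
    Lipschitz a uniform deviation of order [N] would force it to be of order [N^3]. Expectations
    are controlled directly on Feller's iteration, for which functions that are quadratic in time
    serve as supersolutions of the backward equation. Uniqueness follows because two limits must
    charge a common configuration, provided approximating configurations exist. *)

Require Import Defs.
From HB Require Import structures.
From mathcomp Require Import all_boot all_order all_algebra.
From mathcomp Require Import all_classical all_reals all_analysis.
From mathcomp Require Import zify ring lra.
Import Order.TTheory GRing.Theory Num.Theory.
Import numFieldNormedType.Exports.
Local Open Scope classical_set_scope.
Local Open Scope ring_scope.

Set Implicit Arguments.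
Unset Strict Implicit.
Unset Printing Implicit Defensive.

(** * Integrals and Duhamel formula *)

(** With k = 0 the particle noise would accumulate, over a time N^2 t, to order N^3, the size of the
    threshold itself. A fixed large k makes it a small fraction of that, and smoothing then costs
    only O(k N^2). So k depends on the tolerance and not on N.

    The mass has no restoring force: it performs a symmetric walk of rate j/N, without deaths at 0,
    so m wanders by order sqrt N. Hence m is taken out of h and followed separately. Only m^2 has a
    usable drift, so |m| enters through |m| <= d + m^2/d with d proportional to N, and the m^2 thus
    appearing in the drift of Phi is what makes the supersolutions quadratic in time.

    Lower bounds on probabilities need total mass one, while the transition function is only a limit
    of sub-probabilities; non-explosion is therefore proved, by counting jumps.

    [approximates] imposes its inequalities at every N >= 1 and not only for large N; the constants
    19/20, 1/5 and j/8 come from the small values of N. *)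

Section RealIntegrals.
Context {R : realType}.
Notation mu := (@lebesgue_measure R).
Implicit Types (f F g : R -> R) (a b t : R).

Lemma continuous_integrable_itv f a b :
  continuous f -> mu.-integrable `[a, b] (EFin \o f).
Proof.
move=> cf; apply: continuous_compact_integrable; first exact: segment_compact.
exact: continuous_subspaceT.
Qed.

Lemma Rintegral_FTC2 f F a b : a <= b ->
  (forall x : R, is_derive x (1 : R) F (f x)) -> continuous f ->
  \int[mu]_(x in `[a, b]) f x = F b - F a.
Proof.
move=> + dF cf; rewrite le_eqVlt => /predU1P[<-|ab].
  by rewrite set_itv1 Rintegral_set1 subrr.
have cF : continuous F.
  by move=> x; apply/differentiable_continuous/derivable1_diffP; exact: ex_derive.
rewrite /Rintegral (@continuous_FTC2 _ f F)//.
- exact: continuous_subspaceT.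
- split=> [x _||]; first exact: ex_derive.
  + exact/cvg_at_right_filter/cF.
  + exact/cvg_at_left_filter/cF.
- by move=> x _; rewrite derive1E derive_val.
Qed.

Lemma continuous_parameterized_integral g :
  continuous g -> continuous (fun t => \int[mu]_(s in `[0, t]) g s).
Proof.
move=> cg t.
pose B := `|t| + 1.
have B0 : - B < B by rewrite /B; have := normr_ge0 t; lra.
have ig : mu.-integrable `[(- B), B] (EFin \o g) by exact: continuous_integrable_itv.
pose h x := \int[mu]_(s in `[(- B), x]) g s.
have ch : {in `](- B), B[, continuous h}.
  have := parameterized_integral_continuous (ltW B0) ig.
  by move=> /(continuous_within_itvP _ B0)[].
have tB : - B < t < B.
  by rewrite /B -ltr_norml ltrDl.
(* For [x < 0] the interval [0, x] is empty and its integral is 0; [Num.max x 0] reproduces this on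
   both sides of 0. *)
have eqh : {near nbhs t, (fun x => h (Num.max x 0) - h 0) =1
              (fun x => \int[mu]_(s in `[0, x]) g s)}.
  near=> x.
  have [x0|x0] := leP x 0.
    rewrite subrr; case: (eqVneq x 0) => [->|xn0].
      by rewrite set_itv1 Rintegral_set1.
    by rewrite set_itv_ge ?Rintegral_set0// bnd_simp -ltNge lt_neqAle xn0.
  have xB : - B < x < B.
    near: x; apply: (@near_in_itvoo _ (- B) B); by rewrite in_itv.
  rewrite /h Rintegral_itvB ?bnd_simp.
  - rewrite Rintegral_itv_obnd_cbnd//.
    apply: integrableS (continuous_integrable_itv 0 x cg) => //.
    exact: subset_itv_oc_cc.
  - exact: continuous_integrable_itv.
  - lra.
  - exact: ltW.
apply: cvg_trans; first exact: (near_eq_cvg eqh).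
have -> : \int[mu]_(s in `[0, t]) g s = h (Num.max t 0) - h 0.
  by rewrite (nbhs_singleton eqh).
apply: cvgB; last exact: cvg_cst.
have cm : {for t, continuous (fun x : R => Num.max x 0)}.
  by apply: continuous_max; [exact: cvg_id|exact: cvg_cst].
apply: (continuous_comp cm).
by apply: ch; rewrite in_itv/= /Num.max; case: ifP => _; lra.
Unshelve. all: by end_near. Qed.

Lemma Rintegral_reflect g t : 0 <= t -> continuous g ->
  \int[mu]_(s in `[0, t]) g (t - s) = \int[mu]_(s in `[0, t]) g s.
Proof.
move=> t0 cg; pose F x := t - x.
have dF (x : R) : is_derive x (1 : R) F (-1) by rewrite /F; apply: is_derive_eq; ring.
have F' : derive1 F = cst (-1) by apply/funext => x; rewrite derive1E derive_val.
have cF : continuous F.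
  by move=> x; apply/differentiable_continuous/derivable1_diffP; exact: ex_derive.
have := @integration_by_substitution_decreasing _ F g 0 t t0.
rewrite F' /F subr0 subrr => H; rewrite /Rintegral H//.
- congr fine; apply: eq_integral => x _ /=; congr EFin.
  by rewrite !fctE /= opprK mulr1.
- by move=> x y _ _ xy; lra.
- by move=> x _; exact: cvg_cst.
- exact: is_cvg_cst.
- exact: is_cvg_cst.
- split=> [x _||]; first exact: (@ex_derive _ _ _ _ _ _ _ (dF x)).
  + exact/cvg_at_right_filter/cF.
  + exact/cvg_at_left_filter/cF.
- exact: continuous_subspaceT.
Qed.

(** The reflection s -> t - s leaves an integrand free of [t], up to the factor exp(-qt), so
    continuity in the endpoint suffices. *)
Lemma continuous_exp_convolution (q : R) g : continuous g ->
  continuous (fun t => \int[mu]_(s in `[0, t]) (expR (- q * s) * g (t - s))).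
Proof.
move=> cg.
have cl (p : R) : continuous (fun s : R => expR (p * s)).
  move=> s; apply: (@continuous_comp _ _ _ (fun s => p * s) expR).
    by apply: cvgMr; exact: cvg_id.
  exact: continuous_expR.
have ck : continuous (fun s => expR (q * s) * g s).
  by move=> s; apply: cvgM; [exact: cl|exact: cg].
suff -> : (fun t => \int[mu]_(s in `[0, t]) (expR (- q * s) * g (t - s))) =
    (fun t => expR (- q * t) * \int[mu]_(s in `[0, t]) (expR (q * s) * g s)).
  move=> t; apply: cvgM; first exact: cl.
  exact: continuous_parameterized_integral.
apply/funext => t; have [t0|t0] := ltP t 0.
  by rewrite set_itv_ge ?Rintegral_set0 ?mulr0// bnd_simp -ltNge.
rewrite -[in RHS]Rintegral_reflect// -RintegralZl//; last first.
  apply: continuous_integrable_itv.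
  move=> s; apply: (@continuous_comp _ _ _ (fun s => t - s) (fun s => expR (q * s) * g s)).
    by apply: cvgB; [exact: cvg_cst|exact: cvg_id].
  exact: ck.
apply: eq_Rintegral => s _; rewrite mulrA -expRD; congr (expR _ * _); ring.
Qed.

(** With y(u) = a + b u + c u^2, the integrand is the derivative in s of -exp(-qs) y(t - s). *)
Lemma duhamel_quadratic (q a b c t : R) : 0 <= t ->
  \int[mu]_(s in `[0, t]) (expR (- q * s) *
     (q * (a + b * (t - s) + c * (t - s) ^+ 2) + b + 2 * c * (t - s))) =
  a + b * t + c * t ^+ 2 - expR (- q * t) * a.
Proof.
move=> t0.
pose F s := - (expR (- q * s) * (a + b * (t - s) + c * (t - s) ^+ 2)).
pose f s := expR (- q * s) *
     (q * (a + b * (t - s) + c * (t - s) ^+ 2) + b + 2 * c * (t - s)).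
have dF (x : R) : is_derive x (1 : R) F (f x).
  rewrite /F /f; apply: is_derive_eq.
  rewrite /GRing.scale/= ; ring.
have cf : continuous f.
  have df (x : R) : derivable f x (1 : R) by rewrite /f; exact: ex_derive.
  by move=> x; apply/differentiable_continuous/derivable1_diffP.
rewrite (Rintegral_FTC2 t0 dF cf) /F !mulr0 expR0 !subr0 !subrr; ring.
Qed.

End RealIntegrals.

(** * Feller's iteration *)

Section FellerIteration.
Context {R : realType} (j : R) (N : nat).
Hypothesis j_ge0 : 0 <= j.
Notation mu := (@lebesgue_measure R).
Notation J := (@jumps R j N).
Notation q := (@qrate R j N).
Implicit Types (xi eta : conf N) (s : seq (conf N)) (f : conf N -> R).

Lemma jumps_ge0 xi p : p \in J xi -> 0 <= p.1.
Proof.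
rewrite mem_cat => /orP[/flattenP[l /mapP[i _ ->]]|].
  by rewrite !inE => /orP[] /eqP-> /=; rewrite divr_ge0.
by rewrite !inE => /orP[] /eqP-> /=; [|case: ifP => _ //]; rewrite divr_ge0.
Qed.

Lemma qrate_ge0 xi : 0 <= q xi.
Proof. by rewrite /qrate big_seq sumr_ge0// => p /jumps_ge0. Qed.

(** For duplicate-free [s], the expectation of [f] on the event of at most [n] jumps and a final
    configuration in [s]. The truncations keep every sum finite. *)
Definition sumpn f s n t xi : R := \sum_(eta <- s) f eta * pn j n t xi eta.

Lemma continuous_sum_seq (T : eqType) (l : seq T) (g : T -> R -> R) :
  (forall x, x \in l -> continuous (g x)) ->
  continuous (fun t => \sum_(x <- l) g x t).
Proof.
elim: l => [|x l IH] cg.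
  under eq_fun do rewrite big_nil.
  by move=> t; exact: cvg_cst.
under eq_fun do rewrite big_cons.
move=> t; apply: cvgD; first by apply: cg; rewrite mem_head.
by apply: IH => y yl; apply: cg; rewrite inE yl orbT.
Qed.

Lemma continuous_expRM (c : R) : continuous (fun t : R => expR (c * t)).
Proof.
move=> t; apply: (@continuous_comp _ _ _ (fun t => c * t) expR).
  by apply: cvgMr; exact: cvg_id.
exact: continuous_expR.
Qed.

Lemma pn_continuous n xi eta : continuous (fun t => pn j n t xi eta).
Proof.
elim: n xi => [|n IH] xi /=.
  by move=> t; apply: cvgMr; exact: continuous_expRM.
move=> t; apply: cvgD; first by apply: cvgMr; exact: continuous_expRM.
apply: (@continuous_exp_convolution R (q xi)
  (fun u => \sum_(p <- J xi) p.1 * pn j n u p.2 eta)).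
apply: (@continuous_sum_seq _ (J xi) (fun p u => p.1 * pn j n u p.2 eta)).
by move=> p _ u; apply: cvgMr; exact: IH.
Qed.

Lemma jump_term_continuous xi (g : conf N -> R -> R) (t : R) :
  (forall eta, continuous (g eta)) ->
  continuous (fun u => expR (- q xi * u) * \sum_(p <- J xi) p.1 * g p.2 (t - u)).
Proof.
move=> cg u; apply: cvgM; first exact: continuous_expRM.
apply: (@continuous_sum_seq _ (J xi) (fun p u => p.1 * g p.2 (t - u))) => p _ v.
apply: cvgMr; apply: (@continuous_comp _ _ _ (fun u => t - u) (g p.2)); last exact: cg.
by apply: cvgB; [exact: cvg_cst|exact: cvg_id].
Qed.

Lemma Rintegral_sum_seq (T : eqType) (l : seq T) (g : T -> R -> R) t :
  (forall x, x \in l -> continuous (g x)) ->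
  \sum_(x <- l) \int[mu]_(u in `[0, t]) g x u =
  \int[mu]_(u in `[0, t]) \sum_(x <- l) g x u.
Proof.
elim: l => [|x l IH] cg.
  under eq_Rintegral do rewrite big_nil.
  by rewrite big_nil Rintegral_cst//= mul0r.
rewrite big_cons IH; last by move=> y yl; apply: cg; rewrite inE yl orbT.
under [RHS]eq_Rintegral do rewrite big_cons.
rewrite RintegralD//.
- by apply: continuous_integrable_itv; apply: cg; rewrite mem_head.
- apply: continuous_integrable_itv; apply: continuous_sum_seq => y yl.
  by apply: cg; rewrite inE yl orbT.
Qed.

Lemma sumpn_continuous f s n xi : continuous (fun t => sumpn f s n t xi).
Proof.
apply: continuous_sum_seq => eta _ t; apply: cvgMr; exact: pn_continuous.
Qed.

Lemma sumpn0 f s t xi :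
  sumpn f s 0 t xi = (\sum_(eta <- s) f eta * (xi == eta)%:R) * expR (- q xi * t).
Proof. by rewrite /sumpn/= big_distrl/=; apply: eq_bigr => eta _; rewrite mulrA. Qed.

(** Decomposition at the first jump, the form needed for induction on the number of jumps. *)
Lemma sumpnS f s n t xi :
  sumpn f s n.+1 t xi = sumpn f s 0 t xi +
    \int[mu]_(u in `[0, t])
      (expR (- q xi * u) * \sum_(p <- J xi) p.1 * sumpn f s n (t - u) p.2).
Proof.
rewrite /sumpn/= -[X in _ = _ + X](_ : \sum_(eta <- s) f eta *
  \int[mu]_(u in `[0, t]) (expR (- q xi * u) *
     \sum_(p <- J xi) p.1 * pn j n (t - u) p.2 eta) = _); last first.
  under eq_bigr => eta _.
    rewrite -RintegralZl//; last first.
      apply: continuous_integrable_itv.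
      by apply: (@jump_term_continuous xi (fun z v => pn j n v z eta)) => z; exact: pn_continuous.
    over.
  rewrite Rintegral_sum_seq; last first.
    move=> eta _ u; apply: cvgMr.
    by apply: (@jump_term_continuous xi (fun z v => pn j n v z eta)) => z; exact: pn_continuous.
  apply: eq_Rintegral => u _.
  transitivity (\sum_(eta <- s) \sum_(p <- J xi)
      expR (- q xi * u) * (p.1 * (f eta * pn j n (t - u) p.2 eta))).
    apply: eq_bigr => eta _; rewrite !big_distrr/=.
    by apply: eq_bigr => p _; ring.
  rewrite exchange_big big_distrr/=; apply: eq_bigr => p _.
  by rewrite !big_distrr.
by rewrite -big_split/=; apply: eq_bigr => eta _; rewrite mulrDr.
Qed.

Lemma sum_eq_indic f s xi : uniq s ->
  \sum_(eta <- s) f eta * (xi == eta)%:R = (xi \in s)%:R * f xi.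
Proof.
move=> us; have [xs|xs] := boolP (xi \in s).
  rewrite (bigD1_seq xi)//= eqxx mulr1 mul1r big1 ?addr0// => eta neq.
  by rewrite eq_sym (negbTE neq) mulr0.
rewrite mul0r big1_seq// => eta /= es; case: eqP => [e|_]; last by rewrite mulr0.
by rewrite e es in xs.
Qed.

Lemma pn_ge0 n t xi eta : 0 <= t -> 0 <= pn j n t xi eta.
Proof.
elim: n t xi => [|n IH] t xi t0 /=; first by rewrite mulr_ge0// expR_ge0.
apply: addr_ge0; first by rewrite mulr_ge0// expR_ge0.
apply: Rintegral_ge0 => u /=; rewrite in_itv/= => /andP[u0 ut].
rewrite mulr_ge0 ?expR_ge0// big_seq sumr_ge0// => p /jumps_ge0 p0.
by rewrite mulr_ge0// IH// subr_ge0.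
Qed.

Lemma pn_nondecreasing n t xi eta : 0 <= t -> pn j n t xi eta <= pn j n.+1 t xi eta.
Proof.
elim: n t xi => [|n IH] t xi t0.
  rewrite [leRHS]/= lerDl; apply: Rintegral_ge0 => u /=; rewrite in_itv/= => /andP[u0 ut].
  rewrite mulr_ge0 ?expR_ge0// big_seq sumr_ge0// => p /jumps_ge0 p0.
  by rewrite mulr_ge0// mulr_ge0 ?expR_ge0.
rewrite [leLHS]/= [leRHS]/= lerD2l; apply: le_Rintegral => //.
- apply: continuous_integrable_itv.
  by apply: (@jump_term_continuous xi (fun z v => pn j n v z eta)) => z; exact: pn_continuous.
- apply: continuous_integrable_itv.
  by apply: (@jump_term_continuous xi (fun z v => pn j n.+1 v z eta)) => z; exact: pn_continuous.
- move=> u /=; rewrite in_itv/= => /andP[u0 ut].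
  rewrite ler_wpM2l ?expR_ge0// big_seq [leRHS]big_seq ler_sum// => p /jumps_ge0 p0.
  by rewrite ler_wpM2l// IH// subr_ge0.
Qed.

Definition quad (a b c : conf N -> R) t xi : R := a xi + b xi * t + c xi * t ^+ 2.

Lemma quad_continuous a b c xi : continuous (fun t => quad a b c t xi).
Proof.
have df (x : R) : derivable (fun t => quad a b c t xi) x (1 : R).
  by rewrite /quad; exact: ex_derive.
by move=> x; apply/differentiable_continuous/derivable1_diffP.
Qed.

(** The hypothesis says that [quad] is a supersolution with source [r]. The source is 0 for bounding
    expectations and the jump rate for counting jumps. *)
Lemma duhamel_quad a b c r t xi : 0 <= t ->
  (forall u, 0 <= u -> \sum_(p <- J xi) p.1 * quad a b c u p.2 + r <=
     q xi * quad a b c u xi + b xi + 2 * c xi * u) ->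
  expR (- q xi * t) * a xi + \int[mu]_(u in `[0, t])
    (expR (- q xi * u) * (\sum_(p <- J xi) p.1 * quad a b c (t - u) p.2 + r))
  <= quad a b c t xi.
Proof.
move=> t0 H; rewrite -lerBrDl {2}/quad -duhamel_quadratic//.
apply: le_Rintegral => //.
- apply: continuous_integrable_itv => u; under eq_fun do rewrite mulrDr.
  apply: cvgD.
    apply: (@jump_term_continuous xi (fun z v => quad a b c v z)) => z.
    exact: quad_continuous.
  by apply: cvgMl; exact: continuous_expRM.
- apply: continuous_integrable_itv.
  have df (x : R) : derivable (fun v => expR (- q xi * v) *
     (q xi * (a xi + b xi * (t - v) + c xi * (t - v) ^+ 2) + b xi + 2 * c xi * (t - v)))
     x (1 : R) by exact: ex_derive.
  by move=> x; apply/differentiable_continuous/derivable1_diffP.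
- move=> u /=; rewrite in_itv/= => /andP[u0 ut].
  by rewrite ler_wpM2l ?expR_ge0//; apply: H; rewrite subr_ge0.
Qed.

(** Comparison principle by induction on the number of jumps; no maximum principle on the infinite
    state space is required, since each iterate is controlled separately. *)
Lemma sumpn_le_supersolution f a b c s n t xi : uniq s -> 0 <= t ->
  (forall eta, 0 <= f eta) -> (forall eta, f eta <= a eta) ->
  (forall eta, 0 <= b eta) -> (forall eta, 0 <= c eta) ->
  (forall eta u, 0 <= u -> \sum_(p <- J eta) p.1 * quad a b c u p.2 <=
     q eta * quad a b c u eta + b eta + 2 * c eta * u) ->
  sumpn f s n t xi <= quad a b c t xi.
Proof.
move=> us t0 f0 fa b0 c0 H.
have ind0 u eta : 0 <= u -> sumpn f s 0 u eta <= expR (- q eta * u) * a eta.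
  move=> u0; rewrite sumpn0 sum_eq_indic// mulrC ler_wpM2l ?expR_ge0//.
  by case: (_ \in _); rewrite ?mul1r ?mul0r// (le_trans (f0 eta)).
elim: n t t0 xi => [|n IH] t t0 xi.
  apply: le_trans (ind0 _ _ t0) _; rewrite /quad -addrA.
  apply: (@le_trans _ _ (a xi)).
    rewrite ler_piMl ?(le_trans (f0 xi))// expR_le1 mulNr oppr_le0.
    by rewrite mulr_ge0// qrate_ge0.
  by rewrite lerDl addr_ge0// mulr_ge0// sqr_ge0.
rewrite sumpnS; apply: le_trans; last first.
  apply: (@duhamel_quad a b c 0 t xi t0) => u u0; by rewrite addr0 H.
rewrite lerD// ?ind0//; apply: le_Rintegral => //.
- apply: continuous_integrable_itv.
  apply: (@jump_term_continuous xi (fun z v => sumpn f s n v z)) => z.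
  exact: sumpn_continuous.
- apply: continuous_integrable_itv; under eq_fun do rewrite addr0.
  apply: (@jump_term_continuous xi (fun z v => quad a b c v z)) => z.
  exact: quad_continuous.
- move=> u /=; rewrite in_itv/= => /andP[u0 ut]; rewrite addr0.
  rewrite ler_wpM2l ?expR_ge0// big_seq [leRHS]big_seq ler_sum// => p /jumps_ge0 p0.
  by rewrite ler_wpM2l// IH// subr_ge0.
Qed.

Lemma sumpn1_le1 s n t xi : uniq s -> 0 <= t -> sumpn (fun=> 1) s n t xi <= 1.
Proof.
move=> us t0.
have := @sumpn_le_supersolution (fun=> 1) (fun=> 1) (fun=> 0) (fun=> 0) s n t xi us t0.
rewrite /quad !mul0r !addr0; apply=> // eta u _.
rewrite !mul0r !mulr0 !mul0r !addr0 mulr1 /qrate.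
by apply: ler_sum => p _; rewrite mulr1.
Qed.

(** When [s] contains these configurations, restricting to [s] loses nothing from paths with at most
    [n] jumps. *)
Fixpoint reach n xi : seq (conf N) :=
  if n is n'.+1 then xi :: flatten [seq reach n' p.2 | p <- J xi] else [:: xi].

(** The left side is the probability of more than [n] jumps; Markov's inequality bounds it by the
    expected number of jumps over n + 1. The function b t + c t^2 dominates that expectation, being
    a supersolution with the jump rate as source. *)
Lemma sumpn_ge_nonexplosion (b : conf N -> R) (c : R) s n t xi :
  uniq s -> 0 <= t -> 0 <= c ->
  (forall eta, q eta <= b eta) ->
  (forall eta, \sum_(p <- J eta) p.1 * b p.2 <= q eta * b eta + 2 * c) ->
  {subset reach n xi <= s} ->
  1 - sumpn (fun=> 1) s n t xi <= n.+1%:R^-1 * (b xi * t + c * t ^+ 2).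
Proof.
move=> us t0 c0 qb Hb.
have b0 eta : 0 <= b eta := le_trans (qrate_ge0 eta) (qb eta).
pose a : conf N -> R := fun=> 0; pose cc : conf N -> R := fun=> c.
have quadE u eta : quad a b cc u eta = b eta * u + c * u ^+ 2.
  by rewrite /quad add0r.
have supH eta u : 0 <= u -> \sum_(p <- J eta) p.1 * quad a b cc u p.2 + q eta <=
    q eta * quad a b cc u eta + b eta + 2 * c * u.
  move=> u0; under eq_bigr do rewrite quadE mulrDr mulrA.
  rewrite big_split/= -!big_distrl/= -/(qrate j eta) quadE.
  have := ler_wpM2r u0 (Hb eta); have := qb eta; nra.
have Du eta u : 0 <= u -> \int[mu]_(v in `[0, u])
    (expR (- q eta * v) * (\sum_(p <- J eta) p.1 * quad a b cc (u - v) p.2 + q eta))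
    <= quad a b cc u eta.
  move=> u0; have := @duhamel_quad a b cc (q eta) u eta u0.
  rewrite mulr0 add0r; apply => v v0; exact: supH.
have Dq eta u : 0 <= u -> \int[mu]_(v in `[0, u]) (expR (- q eta * v) * q eta) =
    1 - expR (- q eta * u).
  move=> u0; have := @duhamel_quadratic R (q eta) 1 0 0 u u0.
  rewrite !mul0r !addr0 mulr1 => <-; apply: eq_Rintegral => v _; congr (_ * _); ring.
have s0 eta u : eta \in s -> sumpn (fun=> 1) s 0 u eta = expR (- q eta * u).
  by move=> es; rewrite sumpn0 sum_eq_indic// es !mul1r.
elim: n t t0 xi => [|n IH] t t0 xi sub.
  rewrite s0; last by apply: sub; rewrite mem_head.
  rewrite invr1 mul1r -Dq// -quadE; apply: le_trans (Du _ _ t0); apply: le_Rintegral => //.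
  - by apply: continuous_integrable_itv => u; apply: cvgMl; exact: continuous_expRM.
  - apply: continuous_integrable_itv => u; under eq_fun do rewrite mulrDr.
    apply: cvgD; last by apply: cvgMl; exact: continuous_expRM.
    apply: (@jump_term_continuous xi (fun z v => quad a b cc v z)) => z.
    exact: quad_continuous.
  - move=> u /=; rewrite in_itv/= => /andP[u0 ut].
    rewrite ler_wpM2l ?expR_ge0// lerDr big_seq sumr_ge0// => p /jumps_ge0 p0.
    rewrite mulr_ge0// quadE addr_ge0 ?mulr_ge0 ?sqr_ge0// subr_ge0//.
have xs : xi \in s by apply: sub; rewrite /= mem_head.
have subp p : p \in J xi -> {subset reach n p.2 <= s}.
  move=> pJ eta er; apply: sub; rewrite /= inE; apply/orP; right.
  by apply/flattenP; exists (reach n p.2) => //; apply/mapP; exists p.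
rewrite sumpnS s0//.
set I := \int[mu]_(u in _) _.
have cS (z : conf N) : continuous (fun v => sumpn (fun=> 1) s n v z).
  exact: sumpn_continuous.
have I0 : 0 <= I.
  apply: Rintegral_ge0 => u /=; rewrite in_itv/= => /andP[u0 ut].
  rewrite mulr_ge0 ?expR_ge0// big_seq sumr_ge0// => p /jumps_ge0 p0.
  rewrite mulr_ge0// sumr_ge0// => eta _; rewrite mul1r pn_ge0// subr_ge0//.
have D1 : 1 - expR (- q xi * t) - I = \int[mu]_(u in `[0, t]) (expR (- q xi * u) *
    \sum_(p <- J xi) p.1 * (1 - sumpn (fun=> 1) s n (t - u) p.2)).
  rewrite -Dq// -RintegralB//.
  - apply: eq_Rintegral => u _; rewrite -mulrBr; congr (_ * _).
    rewrite /qrate -sumrB; apply: eq_bigr => p _; ring.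
  - by apply: continuous_integrable_itv => u; apply: cvgMl; exact: continuous_expRM.
  - apply: continuous_integrable_itv.
    exact: (@jump_term_continuous xi (fun z v => sumpn (fun=> 1) s n v z)).
(* The first jump counts for one, and the induction hypothesis after it for n + 1 times the
   probability of more than [n] further jumps. *)
have DI : 1 - expR (- q xi * t) <= \int[mu]_(v in `[0, t])
    (expR (- q xi * v) * (\sum_(p <- J xi) p.1 * quad a b cc (t - v) p.2 + q xi)) -
    n.+1%:R * (1 - expR (- q xi * t) - I).
  rewrite lerBrDr -[X in X + _]Dq// D1 -RintegralZl//; last first.
    apply: continuous_integrable_itv.
    apply: (@jump_term_continuous xi (fun z v => 1 - sumpn (fun=> 1) s n v z)) => z v.
    by apply: cvgB; [exact: cvg_cst|exact: cS].
  rewrite -RintegralD//; first last.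
  - apply: continuous_integrable_itv => u; apply: cvgMr.
    apply: (@jump_term_continuous xi (fun z v => 1 - sumpn (fun=> 1) s n v z)) => z v.
    by apply: cvgB; [exact: cvg_cst|exact: cS].
  - by apply: continuous_integrable_itv => u; apply: cvgMl; exact: continuous_expRM.
  apply: le_Rintegral => //.
  - apply: continuous_integrable_itv => u; apply: cvgD.
      by apply: cvgMl; exact: continuous_expRM.
    apply: cvgMr.
    apply: (@jump_term_continuous xi (fun z v => 1 - sumpn (fun=> 1) s n v z)) => z v.
    by apply: cvgB; [exact: cvg_cst|exact: cS].
  - apply: continuous_integrable_itv => u; under eq_fun do rewrite mulrDr.
    apply: cvgD; last by apply: cvgMl; exact: continuous_expRM.
    apply: (@jump_term_continuous xi (fun z v => quad a b cc v z)) => z.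
    exact: quad_continuous.
  move=> u /=; rewrite in_itv/= => /andP[u0 ut].
  rewrite mulrCA -mulrDr ler_wpM2l ?expR_ge0// addrC lerD2r big_distrr/=.
  rewrite big_seq [leRHS]big_seq ler_sum// => p pJ.
  rewrite mulrCA ler_wpM2l ?(jumps_ge0 pJ)// quadE -ler_pdivlMl//.
  by apply: IH => //; [rewrite subr_ge0|exact: subp].
have := Du xi t t0; rewrite quadE => DT.
rewrite ler_pdivlMl// -[n.+2%:R]natr1; lra.
Qed.

End FellerIteration.

(** * Transition probabilities and a Lyapunov bound *)

Section TransitionProbabilities.
Context {R : realType} (j : R) (N : nat).
Hypothesis j_ge0 : 0 <= j.
Notation J := (@jumps R j N).
Notation q := (@qrate R j N).
Implicit Types (xi eta : conf N) (s : seq (conf N)) (A B : set (conf N)).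

Lemma pn_le1 n t xi eta : 0 <= t -> pn j n t xi eta <= 1.
Proof.
move=> t0; have := @sumpn1_le1 R j N j_ge0 [:: eta] n t xi isT t0.
by rewrite /sumpn big_seq1 mul1r.
Qed.

Lemma pn_nondecreasing_seq t xi eta : 0 <= t ->
  nondecreasing_seq (fun n => pn j n t xi eta).
Proof. by move=> t0; apply/nondecreasing_seqP => n; exact: pn_nondecreasing. Qed.

Lemma pn_cvg t xi eta : 0 <= t -> cvgn (fun n => pn j n t xi eta).
Proof.
move=> t0; apply: nondecreasing_is_cvgn; first exact: pn_nondecreasing_seq.
by exists 1 => _ [n _ <-]; exact: pn_le1.
Qed.

Lemma pn_le_ptrans n t xi eta : 0 <= t -> pn j n t xi eta <= ptrans j t xi eta.
Proof.
move=> t0; apply: (@nondecreasing_cvgn_le R (fun n => pn j n t xi eta)).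
  exact: pn_nondecreasing_seq.
exact: pn_cvg.
Qed.

Lemma ptrans_ge0 t xi eta : 0 <= t -> 0 <= ptrans j t xi eta.
Proof. by move=> t0; exact: le_trans (pn_ge0 j_ge0 0 xi eta t0) (pn_le_ptrans _ _ _ t0). Qed.

Lemma sum_ptrans_le1 s t xi : uniq s -> 0 <= t ->
  \sum_(eta <- s) ptrans j t xi eta <= 1.
Proof.
move=> us t0.
have cs : (fun n => \sum_(eta <- s) pn j n t xi eta) @ \oo -->
    \sum_(eta <- s) ptrans j t xi eta.
  elim: s {us} => [|eta s IH].
    rewrite big_nil; under eq_cvg do rewrite big_nil.
    exact: cvg_cst.
  rewrite big_cons; under eq_cvg do rewrite big_cons.
  by apply: cvgD; [exact: pn_cvg|exact: IH].
apply: (cvgr_to_le cs); near=> n.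
have := sumpn1_le1 j_ge0 n xi us t0; rewrite /sumpn.
by under eq_bigr do rewrite mul1r.
Unshelve. all: by end_near. Qed.

Lemma probat_le1 t xi A : 0 <= t -> (probat j xi t A <= 1)%E.
Proof.
move=> t0; apply: ge_ereal_sup => _ [X [finX XA] <-].
rewrite fsbig_finite//= sumEFin lee_fin; apply: sum_ptrans_le1 => //.
exact: finmap.fset_uniq.
Qed.

Lemma probat_disjoint t xi A B : 0 <= t -> A `&` B = set0 ->
  (probat j xi t A + probat j xi t B <= 1)%E.
Proof.
move=> t0 AB0; have := probat_le1 xi (A `|` B) t0; rewrite {1}/probat.
rewrite (esumID A); last by move=> eta _; rewrite lee_fin ptrans_ge0.
rewrite setUK.
have -> // : (A `|` B) `&` ~` A = B.
apply/seteqP; split=> [eta [[|]]//|eta Be]; split; [by right|move=> Ae].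
by have : (A `&` B) eta by []; rewrite AB0.
Qed.

(** Markov's inequality for [f] bounds the mass outside [A]. To turn this into a lower bound for
    [A], nearly all the mass must be present after finitely many jumps; [d] and [e] supply this
    through non-explosion. *)
Lemma probat_ge_lyapunov (f a b c d : conf N -> R) (e K t : R) xi A :
  0 <= t -> 0 < K -> (forall eta, 0 <= f eta) -> (forall eta, ~ A eta -> K <= f eta) ->
  (forall eta, f eta <= a eta) ->
  (forall eta, 0 <= b eta) -> (forall eta, 0 <= c eta) ->
  (forall eta u, 0 <= u -> \sum_(p <- J eta) p.1 * quad a b c u p.2 <=
     q eta * quad a b c u eta + b eta + 2 * c eta * u) ->
  0 <= e -> (forall eta, q eta <= d eta) ->
  (forall eta, \sum_(p <- J eta) p.1 * d p.2 <= q eta * d eta + 2 * e) ->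
  ((1 - quad a b c t xi / K)%:E <= probat j xi t A)%E.
Proof.
move=> t0 K0 f0 fA fa b0 c0 Hsup e0 qd Hd; apply/lee_addgt0Pr => r r0.
pose D := d xi * t + e * t ^+ 2.
have D0 : 0 <= D.
  by rewrite addr_ge0// mulr_ge0 ?sqr_ge0// (le_trans (qrate_ge0 j_ge0 xi)).
(* Enough jumps for the non-explosion bound D / (n + 1) to be at most [r]. *)
pose n := Num.truncn (D / r).
have Dn : n.+1%:R^-1 * D <= r.
  rewrite mulrC ler_pdivrMr//.
  by rewrite -ler_pdivrMl// mulrC ltW// truncnS_gt.
pose s := undup (reach j n xi).
have us : uniq s by exact: undup_uniq.
have ne : 1 - sumpn j (fun=> 1) s n t xi <= r.
  apply: le_trans Dn; apply: sumpn_ge_nonexplosion => //.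
  by move=> eta; rewrite mem_undup.
have bad : \sum_(eta <- s | ~~ `[< A eta >]) pn j n t xi eta <= quad a b c t xi / K.
  rewrite ler_pdivlMr// big_distrl/=.
  apply: le_trans (sumpn_le_supersolution j_ge0 n xi us t0 f0 fa b0 c0 Hsup) => //.
  rewrite /sumpn big_mkcond/=; apply: ler_sum => eta _; case: ifPn => [/asboolPn nA|_].
    by rewrite mulrC ler_wpM2r ?pn_ge0//; exact: fA.
  by rewrite mulr_ge0// pn_ge0.
pose s' := [seq eta <- s | `[< A eta >]].
have good : 1 - r - quad a b c t xi / K <= \sum_(eta <- s') ptrans j t xi eta.
  have : sumpn j (fun=> 1) s n t xi = \sum_(eta <- s | `[< A eta >]) pn j n t xi eta +
      \sum_(eta <- s | ~~ `[< A eta >]) pn j n t xi eta.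
    by rewrite /sumpn (bigID (fun eta => `[< A eta >]))/=; congr (_ + _);
      apply: eq_bigr => eta _; rewrite mul1r.
  have : \sum_(eta <- s | `[< A eta >]) pn j n t xi eta <= \sum_(eta <- s') ptrans j t xi eta.
    by rewrite big_filter; apply: ler_sum => eta _; exact: pn_le_ptrans.
  move: ne bad; lra.
rewrite -leeBlDr// -EFinB; apply: esum_ge; exists [set` s'].
  split; first exact: finite_seq.
  by move=> eta /=; rewrite mem_filter => /andP[/asboolP].
rewrite -fsbig_seq ?filter_uniq// sumEFin lee_fin; lra.
Qed.

End TransitionProbabilities.

(** * The Dirichlet smoothing kernel *)

Section DirichletSmoothing.
Context {R : realType} (N : nat).
Implicit Types (f g u s : nat -> R) (k n x y : nat).

(** Inside, [dsm f - f] is a quarter of the discrete Laplacian; the value 0 elsewhere kills the walk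
    at 0 and N + 1. The weights are the convolution square of (1/2, 1/2), so on the full line the
    powers are binomial. *)
Definition dsm f : nat -> R := fun x =>
  if (0 < x <= N)%N then (f x.-1 + 2 * f x + f x.+1) / 4 else 0.

Definition dirichlet f := f 0%N = 0 /\ f N.+1 = 0.

Definition dot f g : R := \sum_(1 <= x < N.+1) f x * g x.

Lemma dsm_dirichlet f : dirichlet (dsm f).
Proof. by split; rewrite /dsm//= ltnn. Qed.

Lemma iter_dsm_dirichlet k f : dirichlet f -> dirichlet (iter k dsm f).
Proof. by case: k => [|k]// _; exact: dsm_dirichlet. Qed.

Lemma iter_dsm_linear k (a : R) f g :
  iter k dsm (fun x => f x + a * g x) =
  (fun x => iter k dsm f x + a * iter k dsm g x).
Proof.
elim: k => [|k IH]//=; rewrite IH; apply/funext => x; rewrite /dsm.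
by case: ifP => _; [field|rewrite mulr0 addr0].
Qed.

Lemma dotC f g : dot f g = dot g f.
Proof. by apply: eq_bigr => x _; rewrite mulrC. Qed.

Lemma dotDZl (a : R) f g s : dot (fun x => f x + a * g x) s = dot f s + a * dot g s.
Proof.
by rewrite /dot big_distrr/= -big_split/=; apply: eq_bigr => x _; ring.
Qed.

Lemma dotDZr (a : R) f g s : dot s (fun x => f x + a * g x) = dot s f + a * dot s g.
Proof. by rewrite dotC dotDZl !(dotC s). Qed.

Lemma sum_pred_shift f g : f 0%N = 0 -> g N.+1 = 0 ->
  \sum_(1 <= x < N.+1) f x.-1 * g x = \sum_(1 <= x < N.+1) f x * g x.+1.
Proof.
move=> f0 gN; rewrite big_add1/=.
transitivity (\sum_(0 <= x < N.+1) f x * g x.+1).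
  by rewrite big_nat_recr//= gN mulr0 addr0.
by rewrite [LHS]big_ltn// f0 mul0r add0r.
Qed.

Lemma dot_dsm f g : dirichlet f -> dirichlet g -> dot (dsm f) g = dot f (dsm g).
Proof.
move=> [f0 fN] [g0 gN].
have E (u v : nat -> R) : dot (dsm u) v = (\sum_(1 <= x < N.+1) u x.-1 * v x +
    2 * \sum_(1 <= x < N.+1) u x * v x + \sum_(1 <= x < N.+1) u x.+1 * v x) / 4.
  rewrite /dot big_distrr/= -!big_split/= big_distrl/=.
  rewrite big_nat [RHS]big_nat; apply: eq_bigr => x /andP[x0 xN].
  by rewrite /dsm x0 -ltnS xN/=; field.
rewrite E (dotC f) E !sum_pred_shift//.
rewrite -(_ : \sum_(1 <= x < N.+1) f x * g x = \sum_(1 <= x < N.+1) g x * f x); last first.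
  by apply: eq_bigr => x _; rewrite mulrC.
rewrite (eq_bigr (fun x => g x.+1 * f x)) => [|x _]; last by rewrite mulrC.
rewrite (eq_bigr (fun x => f x.+1 * g x) (F1 := fun x => g x * f x.+1)) => [|x _].
  ring.
by rewrite mulrC.
Qed.

Lemma dot_iter_dsm k f g : dirichlet f -> dirichlet g ->
  dot (iter k dsm f) g = dot f (iter k dsm g).
Proof.
elim: k g => [|k IH] g df dg//; rewrite [in RHS]iterSr -IH//.
  by rewrite /= dot_dsm//; exact: iter_dsm_dirichlet.
exact: dsm_dirichlet.
Qed.

Lemma dot_iter_dsm2 k f g : dirichlet f -> dirichlet g ->
  dot (iter k dsm f) (iter k dsm g) = dot (iter (k + k) dsm f) g.
Proof.
by move=> df dg; rewrite -dot_iter_dsm -?iterD//; exact: iter_dsm_dirichlet.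
Qed.

(** Dissipativity of the Dirichlet Laplacian, from 2 u(x) u(x+1) <= u(x)^2 + u(x+1)^2 and its mirror
    image. *)
Lemma dot_dsm_le u : dirichlet u -> dot u (dsm u) <= dot u u.
Proof.
move=> [u0 uN].
have A1 : \sum_(1 <= x < N.+1) u x.-1 ^+ 2 <= dot u u.
  rewrite big_add1/= /dot.
  case: N uN => [_|n _]; first by rewrite !big_geq.
  by rewrite big_ltn// u0 expr0n add0r [leRHS]big_nat_recr//= lerDl -expr2 sqr_ge0.
have A2 : \sum_(1 <= x < N.+1) u x.+1 ^+ 2 <= dot u u.
  rewrite /dot; case: N uN => [|n] uN; first by rewrite !big_geq.
  by rewrite big_nat_recr//= uN expr0n addr0 [leRHS]big_add1/= [leRHS]big_ltn//
    lerDr -expr2 sqr_ge0.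
have : dot u (dsm u) <= (\sum_(1 <= x < N.+1) u x.-1 ^+ 2 + 6 * dot u u +
    \sum_(1 <= x < N.+1) u x.+1 ^+ 2) / 8.
  rewrite /dot big_distrr/= -!big_split/= big_distrl/=.
  rewrite big_nat [leRHS]big_nat; apply: ler_sum => x /andP[x0 xN].
  rewrite /dsm x0 -ltnS xN/=.
  have := sqr_ge0 (u x - u x.-1); have := sqr_ge0 (u x - u x.+1); nra.
lra.
Qed.

Lemma dsm_norm_le (C : R) f : 0 <= C ->
  (forall x, (x <= N.+1)%N -> `|f x| <= C) ->
  forall k x, (x <= N.+1)%N -> `|iter k dsm f x| <= C.
Proof.
move=> C0 fC; elim=> [|k IH] x xN /=; first exact: fC.
rewrite /dsm; case: ifPn => [/andP[x0 xN']|_]; last by rewrite normr0.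
have := IH x.-1; have := IH x; have := IH x.+1.
rewrite ltnS xN' (leqW xN') (leq_trans (leq_pred x) (leqW xN')).
move=> /(_ isT); rewrite ler_norml => /andP[a1 a2] /(_ isT).
rewrite ler_norml => /andP[b1 b2] /(_ isT); rewrite ler_norml => /andP[c1 c2].
by rewrite ler_norml; apply/andP; split; lra.
Qed.

Lemma dot_norm_le (C : R) f g :
  (forall x, (0 < x <= N)%N -> `|g x| <= C) ->
  `|dot f g| <= C * \sum_(1 <= x < N.+1) `|f x|.
Proof.
move=> gC; rewrite /dot (le_trans (ler_norm_sum _ _ _))// big_distrr/=.
rewrite big_nat [leRHS]big_nat; apply: ler_sum => x xN.
by rewrite normrM mulrC ler_wpM2r// gC.
Qed.

(** Telescoping: by symmetry each application of P is moved onto [s], whose sup norm P does not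
    increase, so each costs at most C times the sum of |Pf - f|. *)
Lemma dot_iter_dsm_sub n (C : R) f s : 0 <= C -> dirichlet f -> dirichlet s ->
  (forall x, (x <= N.+1)%N -> `|s x| <= C) ->
  `|dot (iter n dsm f) s - dot f s| <=
    n%:R * C * \sum_(1 <= x < N.+1) `|dsm f x - f x|.
Proof.
move=> C0 df ds sC; elim: n => [|n IH]; first by rewrite subrr normr0 !mul0r.
set S := \sum_(1 <= x < N.+1) _ in IH *.
have step : `|dot (iter n.+1 dsm f) s - dot (iter n dsm f) s| <= C * S.
  rewrite iterSr !dot_iter_dsm//; last exact: dsm_dirichlet.
  have -> : dot (dsm f) (iter n dsm s) - dot f (iter n dsm s) =
      dot (fun x => dsm f x + (-1) * f x) (iter n dsm s) by rewrite dotDZl mulN1r.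
  apply: le_trans (dot_norm_le (C := C) _ _) _.
    by move=> x /andP[_ xN]; apply: dsm_norm_le => //; exact: leqW.
  by apply: ler_wpM2l => //; apply: ler_sum => x _; rewrite mulN1r.
rewrite -natr1 mulrDl mul1r mulrDl.
have -> : dot (iter n.+1 dsm f) s - dot f s =
    (dot (iter n dsm f) s - dot f s) +
    (dot (iter n.+1 dsm f) s - dot (iter n dsm f) s) by ring.
by rewrite (le_trans (ler_normD _ _))// lerD.
Qed.

(** Finite propagation: k applications of P see only sites at distance at most k. *)
Lemma iter_dsm_ge (v : R) f p r : (0 < p)%N -> (r <= N)%N ->
  (forall x, (p <= x <= r)%N -> v <= f x) ->
  forall k x, (p + k <= x)%N -> (x + k <= r)%N -> v <= iter k dsm f x.
Proof.
move=> p0 rN fv; elim=> [|k IH] x px xr /=.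
  by apply: fv; apply/andP; split; lia.
have x0 : (0 < x <= N)%N by apply/andP; split; lia.
rewrite /dsm x0; have := IH x.-1; have := IH x; have := IH x.+1.
have -> : (p + k <= x.+1)%N by lia.
have -> : (x.+1 + k <= r)%N by lia.
have -> : (p + k <= x)%N by lia.
have -> : (x + k <= r)%N by lia.
have -> : (p + k <= x.-1)%N by lia.
have -> : (x.-1 + k <= r)%N by lia.
move=> /(_ isT isT) a /(_ isT isT) b /(_ isT isT) c; lra.
Qed.

Definition ndelta y : nat -> R := fun x => (x == y)%:R.

Lemma dot_ndelta f y : (0 < y <= N)%N -> dot f (ndelta y) = f y.
Proof.
move=> yN; rewrite /dot (bigD1_seq y)/= ?mem_index_iota ?ltnS ?iota_uniq//.
rewrite /ndelta eqxx mulr1 big1 ?addr0// => x xy.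
by rewrite (negbTE xy) mulr0.
Qed.

Lemma ndelta_dirichlet y : (0 < y <= N)%N -> dirichlet (ndelta y).
Proof.
move=> /andP[y0 yN]; split; rewrite /ndelta; case: eqP => // e; exfalso; lia.
Qed.

(** Killing only decreases the kernel, and on the full line it is binomial by Pascal's rule applied
    twice. The test guards against truncated subtraction. *)
Lemma iter_dsm_ndelta_le n y x : iter n dsm (ndelta y) x <=
  (if (y <= n + x)%N then 'C(2 * n, n + x - y)%:R else 0) / 4 ^+ n.
Proof.
elim: n x => [|n IH] x.
  rewrite expr0 divr1 /= add0n muln0 /ndelta; case: ltngtP => // xy.
  by rewrite xy subnn bin0.
set b := fun z => if (y <= z)%N then 'C(2 * n, z - y)%:R else 0 : R.
have IH' z : iter n dsm (ndelta y) z <= b (n + z)%N / 4 ^+ n by exact: IH.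
have b0 z : 0 <= b z by rewrite /b; case: ifP.
have ex : 0 <= (4 ^+ n.+1 : R)^-1 by rewrite invr_ge0 exprn_ge0.
rewrite iterS {1}/dsm; case: ifPn => [/andP[x0 _]|_]; last first.
  by rewrite mulr_ge0//; case: ifP.
have bS : b (n + x.-1)%N + 2 * b (n + x)%N + b (n + x.+1)%N <=
    (if (y <= n.+1 + x)%N then 'C(2 * n.+1, n.+1 + x - y)%:R else 0).
  rewrite /b.
  have -> : (n + x.+1 = n.+1 + x)%N by lia.
  case: (leqP y (n.+1 + x)) => yx1; last first.
    have -> : (y <= n + x.-1)%N = false by lia.
    have -> : (y <= n + x)%N = false by lia.
    lra.
  have -> : (2 * n.+1 = (2 * n).+2)%N by lia.
  case: (ltnP (n + x) y) => yx2.
    have -> : (y <= n + x.-1)%N = false by lia.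
    have -> : (n.+1 + x - y = 0)%N by lia.
    rewrite !bin0; lra.
  have e2 : (n.+1 + x - y = (n + x - y).+1)%N by lia.
  rewrite e2.
  case: (ltnP (n + x.-1) y) => yx3.
    have -> : (n + x - y = 0)%N by lia.
    rewrite !bin1 bin0 -!natr1; lra.
  have -> : (n + x - y = (n + x.-1 - y).+1)%N by lia.
  rewrite !binS !natrD; lra.
have := IH' x.-1; have := IH' x; have := IH' x.+1.
have /(ler_wpM2r ex) : b (n + x.-1)%N + 2 * b (n + x)%N + b (n + x.+1)%N <= _ := bS.
have -> : (b (n + x.-1)%N + 2 * b (n + x)%N + b (n + x.+1)%N) / 4 ^+ n.+1 =
  (b (n + x.-1)%N / 4 ^+ n + 2 * (b (n + x)%N / 4 ^+ n) + b (n + x.+1)%N / 4 ^+ n) / 4.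
  by rewrite exprS; field; rewrite expf_neq0.
set B1 := b (n + x.-1)%N / _; set B2 := b (n + x)%N / _; set B3 := b (n + x.+1)%N / _.
set Y := (if _ then _ else _) / _; move: B1 B2 B3 Y => *; lra.
Qed.

Definition central n : R := 'C(2 * n, n)%:R / 4 ^+ n.

(** By symmetry the squared norm is the return probability P^{2k}(y,y), whence the bound by a
    central binomial weight uniform in [y] and N. *)
Lemma dot_iter_ndelta_le k y : (0 < y <= N)%N ->
  dot (iter k dsm (ndelta y)) (iter k dsm (ndelta y)) <= central (k + k).
Proof.
move=> yN; have dy := ndelta_dirichlet yN.
rewrite dot_iter_dsm2// dot_ndelta//.
by apply: le_trans (iter_dsm_ndelta_le _ _ _) _; rewrite leq_addl addnK.
Qed.

End DirichletSmoothing.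

Lemma central_ge0 (R : realType) n : 0 <= central n :> R.
Proof. by rewrite divr_ge0// exprn_ge0. Qed.

Lemma centralS (R : realType) n :
  central n.+1 = central n * ((2 * n + 1)%:R / (2 * n + 2)%:R) :> R.
Proof.
have H : (n.+1 * 'C(2 * n.+1, n.+1) = (2 * (2 * n + 1)) * 'C(2 * n, n))%N.
  have -> : (2 * n.+1 = (2 * n).+2)%N by lia.
  have h1 := mul_bin_diag (2 * n).+2 n.
  have h2 := mul_bin_down (2 * n).+1 n.
  have e : ((2 * n).+1 - n = n.+1)%N by lia.
  rewrite e /= in h2.
  rewrite -h1 /=; nia.
rewrite /central exprS.
have H' : (n%:R + 1) * 'C(2 * n.+1, n.+1)%:R = (2 * (2 * n%:R + 1)) * 'C(2 * n, n)%:R :> R.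
  by rewrite natr1 -natrM H !natrM natrD natrM.
have n0 : (n%:R + 1 : R) != 0 by rewrite natr1 pnatr_eq0.
have -> : 'C(2 * n.+1, n.+1)%:R = (2 * (2 * n%:R + 1)) * 'C(2 * n, n)%:R / (n%:R + 1) :> R.
  by apply: (mulfI n0); rewrite H'; field.
have n02 : (2 * n%:R + 2 : R) != 0.
  by rewrite -[X in _ + X]mulr1 -mulrDr mulf_neq0.
have e4 : (4 ^+ n : R) != 0 by rewrite expf_neq0.
have -> : (2 * n + 1)%:R = 2 * n%:R + 1 :> R by rewrite natrD natrM.
have -> : (2 * n + 2)%:R = 2 * n%:R + 2 :> R by rewrite natrD natrM.
field; rewrite ?n0 ?e4 ?n02//.
Qed.

(** A Wallis-type bound: the induction step is (2n+1)(2n+3) <= (2n+2)^2. *)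
Lemma central_sqr_le (R : realType) n : (central n : R) ^+ 2 <= (2 * n + 1)%:R^-1.
Proof.
elim: n => [|n IH]; first by rewrite /central bin0 expr0 divr1 expr1n invr1.
rewrite centralS exprMn.
have := ler_wpM2r (sqr_ge0 ((2 * n + 1)%:R / (2 * n + 2)%:R)) IH.
move=> /le_trans; apply.
have e : (2 * n.+1 + 1 = 2 * n + 3)%N by lia.
rewrite e [leLHS](_ : _ = (2 * n + 1)%:R / (2 * n + 2)%:R ^+ 2); last first.
  have a0 : (2 * n + 1)%:R != 0 :> R by rewrite pnatr_eq0 addn1.
  have b0 : (2 * n + 2)%:R != 0 :> R by rewrite pnatr_eq0 addn2.
  by move: (2 * n + 1)%:R (2 * n + 2)%:R a0 b0 => a b a0 b0; field; rewrite a0 b0.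
rewrite ler_pdivrMr ?exprn_gt0 ?ltr0n ?addn2// mulrC ler_pdivlMr ?ltr0n ?addn3//.
by rewrite -natrX -natrM ler_nat; nia.
Qed.

(** * Configurations and the generator *)

Section Configurations.
Context {R : realType} (N : nat).
Implicit Types (xi : conf N) (x y i : nat).

(** Unlike [Fd], indexed by all naturals, so that the boundary site N + 1 makes sense. *)
Definition tail xi x : R := \sum_(x <= y < N.+1) (xi (inord y))%:R.

Lemma tail_ge0 xi x : 0 <= tail xi x.
Proof. by rewrite sumr_ge0. Qed.

Lemma tail_out xi x : (N < x)%N -> tail xi x = 0.
Proof. by move=> xN; rewrite /tail big_geq. Qed.

Lemma tail_rec xi x : (x <= N)%N -> tail xi x = (xi (inord x))%:R + tail xi x.+1.
Proof. by move=> xN; rewrite /tail big_ltn. Qed.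

Lemma tailS_le xi x : tail xi x.+1 <= tail xi x.
Proof.
have [xN|xN] := leqP x N; first by rewrite (tail_rec _ xN) lerDr.
by rewrite !tail_out// leqW.
Qed.

Lemma tail_le xi x y : (x <= y)%N -> tail xi y <= tail xi x.
Proof.
elim: y => [|y IH]; first by rewrite leqn0 => /eqP->.
rewrite leq_eqVlt => /predU1P[->//|]; rewrite ltnS => /IH.
exact/le_trans/tailS_le.
Qed.

Lemma Fd_tail xi (x : 'I_N.+1) : (Fd x xi)%:R = tail xi x.
Proof.
rewrite /Fd /tail natr_sum -(big_mkord (fun y => x <= y)%N (fun y => (xi (inord y))%:R)).
have xN : (x <= N.+1)%N by exact/ltnW.
rewrite (big_cat_nat (leq0n x) xN)/= big_nat_cond big1 ?add0r; last first.
  by move=> y /andP[/andP[_ yx]]; rewrite leqNgt yx.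
rewrite big_nat_cond [RHS]big_nat_cond; apply: eq_bigl => y.
by case: (leqP x y) => //=; rewrite ?andbT ?andbF.
Qed.

Lemma sum_eq_nat x i : (i <= N)%N ->
  \sum_(x <= y < N.+1) (y == i)%:R = (x <= i)%:R :> R.
Proof.
move=> iN; have [xi|ix] := leqP x i.
  rewrite (bigD1_seq i)/= ?mem_index_iota ?xi ?ltnS ?iota_uniq// eqxx.
  by rewrite big1 ?addr0// => y /negbTE->.
rewrite big_nat big1// => y /andP[xy _]; case: eqP => // e; exfalso; lia.
Qed.

Lemma inord_eq x y : (x <= N)%N -> (y <= N)%N ->
  ((inord x : 'I_N.+1) == inord y) = (x == y).
Proof. by move=> xN yN; rewrite -val_eqE/= !inordK. Qed.

Lemma tail_cmove xi a b x : (a <= N)%N -> (b <= N)%N -> (0 < xi (inord a))%N ->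
  tail (cmove xi (inord a) (inord b)) x = tail xi x + (x <= b)%:R - (x <= a)%:R.
Proof.
move=> aN bN xa; rewrite -(sum_eq_nat x bN) -(sum_eq_nat x aN) /tail -big_split/= -sumrB.
rewrite big_nat [RHS]big_nat; apply: eq_bigr => y /andP[_ yN].
rewrite ffunE !inord_eq// natrD; case: (eqVneq y a) => [->|_]; last by rewrite subn0 subr0.
by rewrite natrB//; ring.
Qed.

Lemma tail_cplus xi x : tail (cplus xi) x = tail xi x + (x == 0%N)%:R.
Proof.
rewrite -leqn0 -(sum_eq_nat x (leq0n N)) /tail -big_split/=.
rewrite big_nat [RHS]big_nat; apply: eq_bigr => y /andP[_ yN].
by rewrite ffunE natrD -(inord_eq yN (leq0n N)) (_ : inord 0 = ord0)//; apply/val_inj/inordK.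
Qed.

Lemma redge_leq xi y : (y <= N)%N -> (0 < xi (inord y))%N -> (y <= redge xi)%N.
Proof.
move=> yN xy; rewrite /redge.
have e : (inord y : 'I_N.+1) = y :> nat by rewrite inordK.
rewrite -{1}e; apply: (@leq_bigmax_cond _ (fun z : 'I_N.+1 => 0 < xi (inord z))%N
  (fun z => nat_of_ord z)).
by rewrite e.
Qed.

Lemma redge_pos xi : xi != [ffun=> 0%N] ->
  (redge xi <= N)%N /\ (0 < xi (inord (redge xi)))%N.
Proof.
move=> xi0; have [y xy] : exists y : 'I_N.+1, (0 < xi y)%N.
  apply/existsP; apply: contraNT xi0 => /existsPn H.
  by apply/eqP/ffunP => y; rewrite ffunE; apply/eqP; rewrite -leqn0 leqNgt H.
have A0 : (0 < #|[pred y : 'I_N.+1 | 0 < xi (inord y)]|)%N.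
  by apply/card_gt0P; exists y; rewrite inE inord_val.
have [z zP e] := eq_bigmax_cond (fun y : 'I_N.+1 => val y) A0.
have -> : redge xi = z by rewrite /redge -e.
by split; [rewrite -ltnS|move: zP; rewrite inE].
Qed.

Lemma redge_empty xi : xi = [ffun=> 0%N] -> redge xi = 0%N.
Proof. by move=> ->; rewrite /redge big_pred0// => y; rewrite ffunE. Qed.

(** This is why removing the rightmost particle lowers F by 1_{F > 0}. The empty configuration is
    excluded because its [redge] is 0 by default. *)
Lemma tail_gt0 xi x : xi != [ffun=> 0%N] -> (0 < tail xi x) = (x <= redge xi)%N.
Proof.
move=> xi0; have [rN rp] := redge_pos xi0.
have [xr|rx] := leqP x (redge xi).
  apply: lt_le_trans (tail_le xi xr); rewrite (tail_rec _ rN).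
  by rewrite ltr_pwDl ?ltr0n ?tail_ge0.
rewrite /tail big_nat big1 ?ltxx// => y /andP[xy yN].
case: (posnP (xi (inord y))) => [->//|/(redge_leq yN) yr]; exfalso; lia.
Qed.

Lemma tail_empty x : tail [ffun=> 0%N] x = 0.
Proof. by rewrite /tail big1// => y _; rewrite ffunE. Qed.

Lemma tail_cminus xi x : xi != [ffun=> 0%N] ->
  tail (cminus xi) x = tail xi x - (0 < tail xi x)%R%:R.
Proof.
move=> xi0; have [rN rp] := redge_pos xi0.
rewrite tail_gt0// -(sum_eq_nat x rN) /tail -sumrB.
rewrite big_nat [RHS]big_nat; apply: eq_bigr => y /andP[_ yN].
rewrite ffunE /= inordK//; case: (eqVneq y (redge xi)) => [->|_]; last by rewrite subn0 subr0.
by rewrite natrB.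
Qed.

Lemma sum_occupation_le xi :
  \sum_(0 <= i < N) ((xi (inord i))%:R + (xi (inord i.+1))%:R) <= 2 * tail xi 0.
Proof.
rewrite big_split/= mulr_natl mulr2n lerD//.
  by rewrite {1}/tail big_nat_recr//= lerDl.
rewrite (tail_rec _ (leq0n _)) -[leLHS]add0r lerD//.
by rewrite /tail big_add1.
Qed.

End Configurations.

(** * The generator and the total mass *)

Section Generator.
Context {R : realType} (j : R) (N : nat).
Hypotheses (j_ge0 : 0 <= j) (N_gt0 : (0 < N)%N).
Implicit Types (xi : conf N) (g : conf N -> R).
Notation tail := (@tail R N).

Definition gen g xi : R := \sum_(p <- jumps j xi) p.1 * (g p.2 - g xi).

Lemma genE g xi : gen g xi = \sum_(p <- jumps j xi) p.1 * g p.2 - qrate j xi * g xi.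
Proof. by rewrite /gen /qrate big_distrl/= -sumrB; apply: eq_bigr => p _; rewrite mulrBr. Qed.

Definition deathrate xi : R := if xi == [ffun=> 0%N] then 0 else j / N%:R.

Lemma sum_jumps (T : R * conf N -> R) xi : \sum_(p <- jumps j xi) T p =
  \sum_(0 <= i < N)
    (T ((xi (inord i))%:R / 2, cmove xi (inord i) (inord i.+1)) +
     T ((xi (inord i.+1))%:R / 2, cmove xi (inord i.+1) (inord i))) +
  T (j / N%:R, cplus xi) + T (deathrate xi, cminus xi).
Proof.
rewrite /jumps big_cat/= big_flatten/= big_map big_cons big_seq1 -addrA; congr (_ + _).
rewrite -[in iota 0 N](subn0 N); apply: eq_bigr => i _.
by rewrite big_cons big_seq1.
Qed.

(** With truncated subtraction the target of a jump of rate zero loses no particle, so increments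
    are prescribed only for jumps that can occur. *)
Lemma gen_moves_births_deaths g (M : nat -> R * R) (b d : R) xi :
  (forall i, (i < N)%N -> (0 < xi (inord i))%N ->
    g (cmove xi (inord i) (inord i.+1)) - g xi = (M i).1) ->
  (forall i, (i < N)%N -> (0 < xi (inord i.+1))%N ->
    g (cmove xi (inord i.+1) (inord i)) - g xi = (M i).2) ->
  g (cplus xi) - g xi = b -> (xi != [ffun=> 0%N] -> g (cminus xi) - g xi = d) ->
  gen g xi = \sum_(0 <= i < N) ((xi (inord i))%:R / 2 * (M i).1 +
     (xi (inord i.+1))%:R / 2 * (M i).2) + j / N%:R * b + deathrate xi * d.
Proof.
move=> M1 M2 Hb Hd; rewrite /gen sum_jumps/= Hb; congr (_ + _ + _).
  rewrite big_nat [RHS]big_nat; apply: eq_bigr => i /andP[_ iN]; congr (_ + _).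
    by case: (posnP (xi (inord i))) => [->|/(M1 _ iN)->//]; rewrite !mul0r.
  by case: (posnP (xi (inord i.+1))) => [->|/(M2 _ iN)->//]; rewrite !mul0r.
by rewrite /deathrate; case: eqP => [_|/eqP /Hd->//]; rewrite !mul0r.
Qed.

Lemma birthrate_ge0 : 0 <= j / N%:R.
Proof. by rewrite divr_ge0. Qed.

Lemma deathrate_ge0 xi : 0 <= deathrate xi.
Proof. by rewrite /deathrate; case: ifP => // _; exact: birthrate_ge0. Qed.

Lemma deathrate_le xi : deathrate xi <= j / N%:R.
Proof. by rewrite /deathrate; case: ifP => // _; exact: birthrate_ge0. Qed.

Lemma tail0_moves xi (g : R -> R) : gen (fun eta => g (tail eta 0)) xi =
  j / N%:R * (g (tail xi 0 + 1) - g (tail xi 0)) +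
  deathrate xi * (g (tail xi 0 - 1) - g (tail xi 0)).
Proof.
rewrite (@gen_moves_births_deaths _ (fun=> (0, 0)) (g (tail xi 0 + 1) - g (tail xi 0))
  (g (tail xi 0 - 1) - g (tail xi 0)))/=.
- by rewrite big1 ?add0r// => i _; rewrite !mulr0 addr0.
- by move=> i iN xp; rewrite tail_cmove// ?addrK ?subrr// ltnW.
- by move=> i iN xp; rewrite tail_cmove// ?addrK ?subrr// ltnW.
- by rewrite tail_cplus.
- by move=> xi0; rewrite tail_cminus// tail_gt0.
Qed.

Lemma gen_mass_le xi : gen (fun eta => tail eta 0) xi <= j / N%:R.
Proof.
rewrite (tail0_moves xi id) addrAC subrr add0r mulr1 addrAC subrr add0r mulrN1.
by rewrite gerBl deathrate_ge0.
Qed.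

(** A symmetric walk gains twice its rate. At mass 0 only births remain, and since G0 >= 0 they move
    the mass towards or past G0 with gain 1 - 2 G0 <= 1. *)
Lemma gen_sqr_mass_le xi (G0 : R) : 0 <= G0 ->
  gen (fun eta => (tail eta 0 - G0) ^+ 2) xi <= 2 * (j / N%:R).
Proof.
move=> G0_ge0; rewrite (tail0_moves xi (fun z => (z - G0) ^+ 2)) /deathrate.
have := birthrate_ge0; case: eqP => [->|_] r0; rewrite ?tail_empty; nra.
Qed.

Lemma qrate_le xi : qrate j xi <= tail xi 0 + 2 * (j / N%:R).
Proof.
rewrite /qrate sum_jumps/= -addrA lerD//; last first.
  by rewrite mulr_natl mulr2n lerD2l deathrate_le.
under eq_bigr do rewrite -mulrDl.
by rewrite -big_distrl/= ler_pdivrMr// mulrC sum_occupation_le.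
Qed.

End Generator.

(** * The Lyapunov functional *)

Section Lyapunov.
Context {R : realType} (j : R) (N k c : nat) (G : nat -> R).
Hypotheses (j_ge0 : 0 <= j) (N_gt0 : (0 < N)%N).
Hypothesis G_ge0 : forall x, 0 <= G x.
Hypothesis G_le : forall x, G x <= G 0%N.
Hypothesis G_out : forall x, (c <= x)%N -> G x = 0.
Hypothesis G_last : G N.+1 = 0.
Hypothesis G_laplace : forall x, (0 < x <= N)%N ->
  G x.-1 - 2 * G x + G x.+1 = 2 * (j / N%:R) * (x < c)%:R.
Implicit Types (xi : conf N) (x i : nat).
Notation tail := (@tail R N).
Notation dsm := (@dsm R N).
Notation dot := (@dot R N).
Notation dirichlet := (@dirichlet R N).
Notation ndelta := (@ndelta R).
Notation r := (j / N%:R).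

(** Harmonic, equal to 1 at 0 and to 0 at N + 1: subtracting [excess * lin] cancels the boundary
    value of F - G without altering its Laplacian. *)
Definition lin x : R := 1 - x%:R / N.+1%:R.
Definition excess xi : R := tail xi 0 - G 0%N.
Definition height xi x : R := tail xi x - G x - excess xi * lin x.
Definition Phi xi : R := dot (iter k dsm (height xi)) (iter k dsm (height xi)).

Lemma lin0 : lin 0 = 1. Proof. by rewrite /lin mul0r subr0. Qed.

Lemma lin_last : lin N.+1 = 0.
Proof. by rewrite /lin divff ?subrr// pnatr_eq0. Qed.

Lemma lin_itv x : (x <= N.+1)%N -> 0 <= lin x <= 1.
Proof.
move=> xN; rewrite /lin subr_ge0 gerBl divr_ge0// andbT.
by rewrite ler_pdivrMr ?ltr0n// mul1r ler_nat.
Qed.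

Lemma height_dirichlet xi : dirichlet (height xi).
Proof.
split; rewrite /height ?lin0 ?lin_last; first by rewrite /excess; ring.
by rewrite tail_out// G_last; ring.
Qed.

(** [birthv] and [deathv] are the increments of [height] under a birth and a death. On sites 1, ...,
    N they add up to -1_{F > 0}, [lin] cancelling. *)
Definition birthv x : R := (x == 0%N)%:R - lin x.
Definition deathv xi x : R := lin x - (0 < tail xi x)%R%:R.

Lemma birthv_dirichlet : dirichlet birthv.
Proof. by split; rewrite /birthv ?lin0 ?lin_last subrr. Qed.

Lemma deathv_dirichlet xi : xi != [ffun=> 0%N] -> dirichlet (deathv xi).
Proof.
move=> xi0; split; rewrite /deathv ?lin0 ?lin_last ?tail_gt0// ?subrr//.
by rewrite -(@tail_gt0 R)// tail_out// ltxx subrr.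
Qed.

Lemma birthv_le1 x : (x <= N.+1)%N -> `|birthv x| <= 1.
Proof.
move=> /lin_itv /andP[l0 l1]; rewrite /birthv ler_norml.
by case: (x == 0%N) => /=; apply/andP; split; lra.
Qed.

Lemma deathv_le1 xi x : (x <= N.+1)%N -> `|deathv xi x| <= 1.
Proof.
move=> /lin_itv /andP[l0 l1]; rewrite /deathv ler_norml.
by case: (0 < _)%R => /=; apply/andP; split; lra.
Qed.

Lemma height_up xi i : (i < N)%N -> (0 < xi (inord i))%N ->
  height (cmove xi (inord i) (inord i.+1)) = fun x => height xi x + 1 * ndelta i.+1 x.
Proof.
move=> iN xp; have iN' := ltnW iN; apply/funext => x.
rewrite /height /excess !tail_cmove//.
rewrite !leq0n /ndelta; have -> : (x <= i.+1)%:R = (x <= i)%:R + (x == i.+1)%:R :> R.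
  by rewrite leq_eqVlt ltnS; case: eqP => [->|_]; rewrite ?ltnn/= ?add0r ?addr0.
ring.
Qed.

Lemma height_down xi i : (i < N)%N -> (0 < xi (inord i.+1))%N ->
  height (cmove xi (inord i.+1) (inord i)) = fun x => height xi x + (-1) * ndelta i.+1 x.
Proof.
move=> iN xp; have iN' := ltnW iN; apply/funext => x.
rewrite /height /excess !tail_cmove//.
rewrite !leq0n /ndelta; have -> : (x <= i.+1)%:R = (x <= i)%:R + (x == i.+1)%:R :> R.
  by rewrite leq_eqVlt ltnS; case: eqP => [->|_]; rewrite ?ltnn/= ?add0r ?addr0.
ring.
Qed.

Lemma height_cplus xi : height (cplus xi) = fun x => height xi x + 1 * birthv x.
Proof. by apply/funext => x; rewrite /height /excess !tail_cplus /birthv/=; ring. Qed.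

Lemma height_cminus xi : xi != [ffun=> 0%N] ->
  height (cminus xi) = fun x => height xi x + 1 * deathv xi x.
Proof.
move=> xi0; apply/funext => x; rewrite /height /excess !tail_cminus// /deathv.
rewrite (_ : (0 < tail xi 0)%R = true) /=; last by rewrite tail_gt0.
ring.
Qed.

Notation w xi := (iter (k + k) dsm (height xi)).
Notation Q v := (dot (iter k dsm v) (iter k dsm v)).

(** Expansion of the square; symmetry of P makes 2 P^{2k} h the gradient of [Phi]. *)
Lemma Phi_shift xi xi' (a : R) v : dirichlet v ->
  height xi' = (fun x => height xi x + a * v x) ->
  Phi xi' - Phi xi = 2 * a * dot (w xi) v + a ^+ 2 * Q v.
Proof.
move=> dv e; rewrite /Phi e iter_dsm_linear dotDZl !dotDZr.
rewrite (dotC N (iter k dsm v)) -dot_iter_dsm2//; last exact: height_dirichlet.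
ring.
Qed.

Lemma Q_le v : (forall x, (x <= N.+1)%N -> `|v x| <= 1) -> Q v <= N%:R.
Proof.
move=> v1; rewrite /dot.
have -> : N%:R = \sum_(1 <= x < N.+1) 1 :> R by rewrite sumr_const_nat subSS subn0.
rewrite big_nat [leRHS]big_nat; apply: ler_sum => x /andP[_ xN].
have := dsm_norm_le ler01 v1 k (ltnW xN); rewrite ler_norml => /andP[]; nra.
Qed.

Lemma rN : r * N%:R = j.
Proof. by rewrite divfK// pnatr_eq0 -lt0n. Qed.

Lemma r_ge0 : 0 <= r. Proof. by rewrite divr_ge0. Qed.

(** Difference of the reaction terms of F and G, cut to sites 1, ..., N so that it meets the
    Dirichlet conditions and P can be moved onto it. *)
Definition mismatch xi x : R :=
  if (0 < x <= N)%N then (0 < tail xi x)%R%:R - (x < c)%:R else 0.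

Lemma mismatch_dirichlet xi : dirichlet (mismatch xi).
Proof. by split; rewrite /mismatch//= ltnn. Qed.

Lemma mismatch_le1 xi x : (x <= N.+1)%N -> `|mismatch xi x| <= 1.
Proof.
move=> _; rewrite /mismatch; case: ifP => _; last by rewrite normr0.
by case: (0 < _)%R; case: (_ < _)%N; rewrite /= ?subrr ?subr0 ?sub0r ?normrN ?normr1 ?normr0.
Qed.

(** The left side is the Laplacian of F, hence that of h plus that of G. *)
Lemma occupation_diff xi x : (0 < x <= N)%N ->
  (xi (inord x.-1))%:R - (xi (inord x))%:R =
    4 * (dsm (height xi) x - height xi x) + 2 * r * (x < c)%:R.
Proof.
move=> xN; have /andP[x0 x1] := xN.
rewrite -G_laplace// /dsm xN /height /lin.
have t1 := @tail_rec R _ xi x x1.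
have t2 : tail xi x.-1 = (xi (inord x.-1))%:R + tail xi x.
  by rewrite (@tail_rec R _ xi x.-1) ?prednK//; exact: leq_trans (leq_pred x) x1.
have ex : (x.-1)%:R = x%:R - 1 :> R by rewrite -[in RHS](prednK x0) -natr1 addrK.
rewrite t2 t1 ex -[(x.+1)%:R]natr1.
have n0 : N.+1%:R != 0 :> R by rewrite pnatr_eq0.
by move: N.+1%:R n0 => n1 n0; field.
Qed.

(** The Laplacian of F is a difference of neighbouring occupation numbers, so its sum of absolute
    values is at most twice the mass. This is of order N when the mass is, and the factor j/N of the
    reaction then makes the smoothing price O(k). *)
Lemma smoothing_variation_le xi :
  \sum_(1 <= x < N.+1) `|dsm (height xi) x - height xi x| <= (tail xi 0 + j) / 2.
Proof.
have -> : (tail xi 0 + j) / 2 = (2 * tail xi 0 + 2 * j) / 4 by field.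
rewrite ler_pdivlMr// mulrC big_distrr/=.
have -> : 2 * j = \sum_(0 <= i < N) (2 * r).
  by rewrite sumr_const_nat subn0 -[RHS]mulr_natr -mulrA rN.
apply: le_trans (lerD (sum_occupation_le xi) (lexx _)).
rewrite -big_split/= big_add1/= big_nat [leRHS]big_nat; apply: ler_sum => i /andP[_ iN].
have -> : 4 * `|dsm (height xi) i.+1 - height xi i.+1| =
    `|4 * (dsm (height xi) i.+1 - height xi i.+1)| by rewrite normrM (@ger0_norm _ 4).
have := @occupation_diff xi i.+1; rewrite ltnS iN/= => /(_ isT) e.
have -> : 4 * (dsm (height xi) i.+1 - height xi i.+1) =
  (xi (inord i))%:R - (xi (inord i.+1))%:R - 2 * r * (i.+1 < c)%:R by rewrite e; ring.
have := r_ge0; have := ler0n R (xi (inord i)); have := ler0n R (xi (inord i.+1)).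
by rewrite ler_norml; case: (_ < _)%N => /=; move=> *; apply/andP; split; lra.
Qed.

(* Monotonicity of the reaction term: [tail - G] and [mismatch] have the same sign. *)
Lemma dot_height_mismatch_ge xi : - dot (height xi) (mismatch xi) <= `|excess xi| * N%:R.
Proof.
have -> : `|excess xi| * N%:R = \sum_(1 <= x < N.+1) `|excess xi|.
  by rewrite sumr_const_nat subSS subn0 mulr_natr.
rewrite /dot -sumrN big_nat [leRHS]big_nat; apply: ler_sum => x /andP[x0 xN].
rewrite /mismatch x0 -ltnS xN/= /height.
have /andP[l0 l1] := lin_itv (ltnW xN).
have lm : - `|excess xi| <= excess xi * lin x <= `|excess xi|.
  rewrite -ler_norml normrM (ger0_norm l0); have := normr_ge0 (excess xi); nra.
have := tail_ge0 (R := R) xi x; have := G_ge0 x; have := normr_ge0 (excess xi).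
case: (ltP 0 (tail xi x)) => tx; case: (ltnP x c) => xc /=; rewrite ?(G_out xc);
  move: lm => /andP[]; nra.
Qed.

(** Monotonicity has a sign against h, not against P^{2k} h; passing from one to the other takes 2k
    smoothing steps. *)
Lemma dot_w_mismatch_ge xi : - dot (w xi) (mismatch xi) <=
  `|excess xi| * N%:R + k%:R * (tail xi 0 + j).
Proof.
have := dot_iter_dsm_sub (k + k) ler01 (height_dirichlet xi) (mismatch_dirichlet xi)
  (@mismatch_le1 xi).
rewrite mulr1 ler_norml natrD => /andP[H _].
have := dot_height_mismatch_ge xi.
have : (k%:R + k%:R) * \sum_(1 <= x < N.+1) `|dsm (height xi) x - height xi x| <=
    (k%:R + k%:R) * ((tail xi 0 + j) / 2).
  by rewrite ler_wpM2l ?smoothing_variation_le// addr_ge0.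
move: H; lra.
Qed.

(** By symmetry both sides are forms in P^k h, where dissipativity applies: diffusion does not
    increase [Phi]. *)
Lemma dot_w_smoothing_le xi : dot (w xi) (dsm (height xi)) <= dot (w xi) (height xi).
Proof.
have dh := height_dirichlet xi.
rewrite -dot_iter_dsm2//; last exact: dsm_dirichlet.
rewrite -dot_iter_dsm2// -iterSr iterS.
exact/dot_dsm_le/iter_dsm_dirichlet.
Qed.

Lemma dot_w_occupation_le xi :
  \sum_(0 <= i < N) ((xi (inord i))%:R - (xi (inord i.+1))%:R) * w xi i.+1 <=
    2 * r * dot (w xi) (fun x => (x < c)%:R).
Proof.
have -> : \sum_(0 <= i < N) ((xi (inord i))%:R - (xi (inord i.+1))%:R) * w xi i.+1 =
   4 * (dot (w xi) (dsm (height xi)) - dot (w xi) (height xi)) +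
   2 * r * dot (w xi) (fun x => (x < c)%:R).
  rewrite /dot -sumrB !big_distrr/= -big_split/= [RHS]big_add1/=.
  rewrite big_nat [RHS]big_nat; apply: eq_bigr => i /andP[_ iN].
  rewrite (@occupation_diff xi i.+1) ?iN//; ring.
by rewrite gerDr pmulr_rle0// subr_le0 dot_w_smoothing_le.
Qed.

Lemma gen_PhiE xi : gen j Phi xi =
  \sum_(0 <= i < N) ((xi (inord i))%:R - (xi (inord i.+1))%:R) * w xi i.+1 +
  \sum_(0 <= i < N) ((xi (inord i))%:R + (xi (inord i.+1))%:R) / 2 * Q (ndelta i.+1) +
  r * (2 * dot (w xi) birthv + Q birthv) +
  deathrate j xi * (2 * dot (w xi) (deathv xi) + Q (deathv xi)).
Proof.
have dn i : (i < N)%N -> (0 < i.+1 <= N)%N by [].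
rewrite (@gen_moves_births_deaths _ _ _ _
  (fun i => (2 * w xi i.+1 + Q (ndelta i.+1), - 2 * w xi i.+1 + Q (ndelta i.+1)))
  (2 * dot (w xi) birthv + Q birthv)
  (2 * dot (w xi) (deathv xi) + Q (deathv xi)))/=.
- by rewrite -big_split/=; congr (_ + _ + _); apply: eq_bigr => i _; field.
- move=> i iN xp; rewrite (Phi_shift (ndelta_dirichlet (dn i iN)) (height_up iN xp)).
  by rewrite dot_ndelta ?dn//; ring.
- move=> i iN xp; rewrite (Phi_shift (ndelta_dirichlet (dn i iN)) (height_down iN xp)).
  by rewrite dot_ndelta ?dn//; ring.
- by rewrite (Phi_shift birthv_dirichlet (height_cplus xi)); ring.
- by move=> xi0; rewrite (Phi_shift (deathv_dirichlet xi0) (height_cminus xi0)); ring.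
Qed.

(** A move changes F at a single site, so its quadratic contribution is a return probability: this
    is where smoothing gains over k = 0. *)
Lemma noise_le xi :
  \sum_(0 <= i < N) ((xi (inord i))%:R + (xi (inord i.+1))%:R) / 2 * Q (ndelta i.+1) <=
    central (k + k) * tail xi 0.
Proof.
apply: (@le_trans _ _ (\sum_(0 <= i < N)
   ((xi (inord i))%:R + (xi (inord i.+1))%:R) * (central (k + k) / 2))).
  rewrite big_nat [leRHS]big_nat; apply: ler_sum => i /andP[_ iN].
  rewrite -mulrA ler_wpM2l ?addr_ge0// mulrC ler_pM2r ?invr_gt0//.
  exact: dot_iter_ndelta_le.
rewrite -big_distrl/=; have := sum_occupation_le (R := R) xi.
have := central_ge0 R (k + k); nra.
Qed.

(** A birth alters h at every site, but its rate is only j/N. *)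
Lemma birth_noise_le : r * Q birthv <= j.
Proof. by rewrite -[leRHS]rN ler_wpM2l ?r_ge0// Q_le//; exact: birthv_le1. Qed.

Lemma death_noise_le xi : deathrate j xi * Q (deathv xi) <= j.
Proof.
apply: (@le_trans _ _ (deathrate j xi * N%:R)).
  by rewrite ler_wpM2l ?deathrate_ge0// Q_le//; exact: deathv_le1.
by rewrite -[leRHS]rN ler_wpM2r// deathrate_le.
Qed.

(** For a nonempty configuration births and deaths have equal rates and the first three terms
    combine exactly into the mismatch. The empty configuration lacks deaths, and the unbalanced
    birth term is paid by the excess. *)
Lemma reaction_le xi :
  2 * r * dot (w xi) (fun x => (x < c)%:R) + 2 * r * dot (w xi) birthv +
  2 * deathrate j xi * dot (w xi) (deathv xi) <=
  2 * r * - dot (w xi) (mismatch xi) + 2 * j * `|excess xi|.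
Proof.
rewrite /deathrate; case: eqP => [xi0|/eqP xi0].
  have e : - dot (w xi) (mismatch xi) = dot (w xi) (fun x => (x < c)%:R).
    rewrite /dot -sumrN big_nat [RHS]big_nat; apply: eq_bigr => x /andP[x0 xN].
    by rewrite /mismatch x0 -ltnS xN/= xi0 tail_empty ltxx sub0r mulrN opprK.
  rewrite e mulr0 mul0r addr0 lerD2l.
  (* Here F = 0, so h = G(0) lin - G and |excess| = G(0). *)
  have hle x : (x <= N.+1)%N -> `|height xi x| <= `|excess xi|.
    move=> xN; have /andP[l0 l1] := lin_itv xN.
    rewrite /height /excess xi0 !tail_empty !sub0r normrN (ger0_norm (G_ge0 0%N)).
    rewrite ler_norml; have := G_ge0 x; have := G_le x; have := G_ge0 0%N.
    by move=> *; apply/andP; split; nra.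
  have : dot (w xi) birthv <= `|excess xi| * N%:R.
    rewrite mulrC /dot.
    have -> : N%:R * `|excess xi| = \sum_(1 <= x < N.+1) `|excess xi|.
      by rewrite sumr_const_nat subSS subn0 mulr_natl.
    rewrite big_nat [leRHS]big_nat; apply: ler_sum => x /andP[x0 xN].
    rewrite (le_trans (ler_norm _))// normrM.
    have := dsm_norm_le (normr_ge0 _) hle (k + k) (ltnW xN).
    have := birthv_le1 (ltnW xN); have := normr_ge0 (birthv x).
    have := normr_ge0 (w xi x); nra.
  move=> H; rewrite -[in leRHS]rN.
  have := ler_wpM2l r_ge0 H; lra.
have e : - dot (w xi) (mismatch xi) = dot (w xi) (fun x => (x < c)%:R) +
    dot (w xi) birthv + dot (w xi) (deathv xi).
  rewrite /dot -sumrN -!big_split/= big_nat [RHS]big_nat.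
  apply: eq_bigr => x /andP[x0 xN].
  rewrite /mismatch x0 -ltnS xN/= /birthv /deathv.
  by case: x x0 xN => // x _ _ /=; ring.
rewrite e; have := mulr_ge0 j_ge0 (normr_ge0 (excess xi)); lra.
Qed.

Lemma gen_Phi_le xi : gen j Phi xi <=
  4 * j * `|excess xi| + 2 * r * k%:R * (tail xi 0 + j) +
  central (k + k) * tail xi 0 + 2 * j.
Proof.
rewrite gen_PhiE.
have H1 := dot_w_occupation_le xi.
have H2 := noise_le xi.
have H3 := birth_noise_le.
have H4 := death_noise_le xi.
have H5 := reaction_le xi.
have H6 := ler_wpM2l (mulr_ge0 (ler0n R 2) r_ge0) (dot_w_mismatch_ge xi).
have e : 2 * r * (`|excess xi| * N%:R) = 2 * j * `|excess xi|.
  by rewrite -[in RHS]rN; ring.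
rewrite mulrDr e in H6.
rewrite !mulrDr.
move: H1 H2 H3 H4 H5 H6; lra.
Qed.

End Lyapunov.

(** * Supersolution for the functional and the resulting probability bound *)

Section Concentration.
Context {R : realType} (j : R) (N k c : nat) (G : nat -> R).
Hypotheses (j_ge0 : 0 <= j) (N_gt0 : (0 < N)%N).
Hypothesis G_ge0 : forall x, 0 <= G x.
Hypothesis G_le : forall x, G x <= G 0%N.
Hypothesis G_out : forall x, (c <= x)%N -> G x = 0.
Hypothesis G_last : G N.+1 = 0.
Hypothesis G_laplace : forall x, (0 < x <= N)%N ->
  G x.-1 - 2 * G x + G x.+1 = 2 * (j / N%:R) * (x < c)%:R.
Implicit Types (xi eta : conf N).
Notation r := (j / N%:R).
Notation Phi := (@Phi R N k G).
Notation excess := (@excess R N G).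
Notation kappa := (central (k + k) : R).

Definition drift_coef : R := 4 * j + 2 * r * k%:R + kappa.
Definition drift_cst (d : R) : R :=
  drift_coef * d + (2 * r * k%:R + kappa) * G 0%N + 2 * r * k%:R * j + 2 * j.

Lemma drift_coef_ge0 : 0 <= drift_coef.
Proof.
by rewrite !addr_ge0 ?central_ge0// !mulr_ge0// divr_ge0.
Qed.

Lemma drift_cst_ge0 d : 0 <= d -> 0 <= drift_cst d.
Proof.
move=> d0; have := central_ge0 R (k + k) => c0.
by rewrite !addr_ge0// !mulr_ge0// ?drift_coef_ge0 ?addr_ge0 ?mulr_ge0 ?divr_ge0.
Qed.

(** Young's inequality with free scale [d] trades |m|, also hidden in the mass F(0) <= G(0) + |m|,
    for m^2, whose drift is bounded. *)
Lemma gen_Phi_le_excess d xi : 0 < d ->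
  gen j Phi xi <= drift_cst d + drift_coef / d * excess xi ^+ 2.
Proof.
move=> d0; apply: le_trans (gen_Phi_le k j_ge0 N_gt0 G_ge0 G_le G_out G_last G_laplace xi) _.
set m := `|excess xi|.
have m0 : 0 <= m by exact: normr_ge0.
have tm : tail xi 0 <= G 0%N + m.
  by rewrite -lerBlDl /m ler_norm.
have md : m <= d + excess xi ^+ 2 / d.
  rewrite -(ger0_norm (sqr_ge0 (excess xi))) normrX -/m.
  rewrite -(ler_pM2r d0) mulrDl divfK ?gt_eqF//.
  have := sqr_ge0 (m - d); have := sqr_ge0 m; have := sqr_ge0 d; nra.
have s0 : 0 <= 2 * r * k%:R + kappa.
  by rewrite addr_ge0 ?central_ge0// !mulr_ge0// divr_ge0.
have H1 := ler_wpM2l s0 tm.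
have H2 := ler_wpM2l drift_coef_ge0 md.
have -> : drift_cst d + drift_coef / d * excess xi ^+ 2 =
  drift_coef * (d + excess xi ^+ 2 / d) + (2 * r * k%:R + kappa) * G 0%N +
  2 * r * k%:R * j + 2 * j by rewrite /drift_cst; ring.
apply: le_trans (lerD (lerD (lerD H2 (lexx _)) (lexx _)) (lexx _)).
rewrite /drift_coef; move: H1; lra.
Qed.

Lemma probat_ge_Phi (d K t : R) xi (A : set (conf N)) : 0 <= t -> 0 < d -> 0 < K ->
  (forall eta, ~ A eta -> K <= Phi eta + N%:R * excess eta ^+ 2) ->
  ((1 - (Phi xi + N%:R * excess xi ^+ 2 +
         (drift_coef / d * excess xi ^+ 2 + drift_cst d + 2 * j) * t +
         drift_coef / d * r * t ^+ 2) / K)%:E <= probat j xi t A)%E.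
Proof.
move=> t0 d0 K0 HA.
pose a eta := Phi eta + N%:R * excess eta ^+ 2.
(* [b] is the drift bound for [a]; its m^2 part itself grows at rate at most 2 j/N, and [cc] absorbs
   this. *)
pose b eta := drift_coef / d * excess eta ^+ 2 + drift_cst d + 2 * j.
pose cc (eta : conf N) := drift_coef / d * r.
have B0 : 0 <= drift_coef / d by rewrite divr_ge0 ?drift_coef_ge0// ltW.
have r0 : 0 <= r by rewrite divr_ge0.
have Phi0 eta : 0 <= Phi eta by rewrite sumr_ge0// => x _; rewrite -expr2 sqr_ge0.
have a0 eta : 0 <= a eta by rewrite addr_ge0// mulr_ge0// sqr_ge0.
(* For non-explosion: the jump rate is at most the mass plus 2 j/N, and the mass has drift at most
   j/N. *)
apply: (@probat_ge_lyapunov R j N j_ge0 a a b cc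
  (fun eta => tail eta 0 + 2 * r) (r / 2)) => //.
- move=> eta; apply: addr_ge0; last exact: mulr_ge0.
  apply: addr_ge0; last exact/drift_cst_ge0/ltW.
  by rewrite mulr_ge0// sqr_ge0.
- by move=> eta; rewrite mulr_ge0.
- move=> eta u u0.
  have -> : \sum_(p <- jumps j eta) p.1 * quad a b cc u p.2 =
      gen j (fun z => quad a b cc u z) eta + qrate j eta * quad a b cc u eta.
    by rewrite genE subrK.
  have -> : gen j (fun z => quad a b cc u z) eta = gen j Phi eta +
      (N%:R + drift_coef / d * u) * gen j (fun z => (tail z 0 - G 0%N) ^+ 2) eta.
    rewrite /gen big_distrr/= -big_split/=; apply: eq_bigr => p _.
    rewrite /quad /a /b /cc /excess; ring.
  have H1 := gen_Phi_le_excess eta d0.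
  have H2 := gen_sqr_mass_le (N := N) j_ge0 eta (G_ge0 0%N).
  have u1 : 0 <= N%:R + drift_coef / d * u by rewrite addr_ge0// mulr_ge0.
  have H3 := ler_wpM2l u1 H2.
  have e : (N%:R + drift_coef / d * u) * (2 * r) = 2 * j + 2 * (drift_coef / d * r) * u.
    by field; rewrite !gt_eqF ?ltr0n.
  rewrite e in H3; rewrite /b /cc; move: H1 H3; lra.
- by rewrite divr_ge0.
- by move=> eta; exact: qrate_le.
- move=> eta.
  have -> : \sum_(p <- jumps j eta) p.1 * (tail p.2 0 + 2 * r) =
      gen j (fun z => tail z 0) eta + qrate j eta * (tail eta 0 + 2 * r).
    rewrite -[LHS](subrK (qrate j eta * (tail eta 0 + 2 * r))); congr (_ + _).
    rewrite -(genE j (fun z => tail z 0 + 2 * r)) /gen.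
    by apply: eq_bigr => p _; congr (_ * _); ring.
  have := gen_mass_le (N := N) j_ge0 eta; lra.
Qed.

End Concentration.

(** * The linear profile and its discrete counterpart *)

Section Profile.
Context {R : realType} (j M : R).
Hypotheses (j_gt0 : 0 < j) (M_ge0 : 0 <= M).
Notation mu := (@lebesgue_measure R).
Implicit Types (r p q : R) (N x : nat).

Definition pos (u : R) : R := Num.max u 0.

Lemma pos_ge0 u : 0 <= pos u. Proof. by rewrite /pos le_max lexx orbT. Qed.

Lemma posE u : 0 <= u -> pos u = u. Proof. by move=> u0; apply/max_idPl. Qed.

Lemma pos0 u : u <= 0 -> pos u = 0. Proof. by move=> u0; apply/max_idPr. Qed.

(** Both regimes become A + 2j(B - r) for r <= B, with B = [pedge] and A = [pvalue], where A = 0 or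
    B = 1. *)
Definition pedge : R := if M < j then Num.sqrt (M / j) else 1.
Definition pvalue : R := if M < j then 0 else M - j.

Lemma pedge_itv : 0 <= pedge <= 1.
Proof.
rewrite /pedge; case: ltP => Mj; last by rewrite ler01 lexx.
by rewrite sqrtr_ge0 -[leRHS]sqrtr1 ler_sqrt// ler_pdivrMr// mul1r ltW.
Qed.

Lemma pvalue_ge0 : 0 <= pvalue.
Proof. by rewrite /pvalue; case: ltP => // Mj; rewrite subr_ge0. Qed.

Lemma pvalue_edge : pvalue = 0 \/ pedge = 1.
Proof. by rewrite /pvalue /pedge; case: ltP; [left|right]. Qed.

Definition pdens r : R := if r <= pedge then pvalue + 2 * j * (pedge - r) else 0.

Definition ptail r : R := pvalue * pos (pedge - r) + j * pos (pedge - r) ^+ 2.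

Lemma rhoM_pdens r : 0 <= r <= 1 -> rhoM j M r = pdens r.
Proof.
move=> /andP[r0 r1]; rewrite /rhoM /pdens /pedge /pvalue.
case: eqP => [->|_].
  rewrite j_gt0 mul0r sqrtr0; case: ifP => // rle.
  by have -> : r = 0 by [apply/eqP; rewrite eq_le rle]; rewrite subrr mulr0 addr0.
by case: ltP => Mj; [rewrite add0r|rewrite r1; ring].
Qed.

Lemma rhoM_ge0 r : 0 <= r <= 1 -> 0 <= rhoM j M r.
Proof.
move=> r01; rewrite rhoM_pdens// /pdens; case: ifP => // rB.
by rewrite addr_ge0 ?pvalue_ge0// !mulr_ge0 ?subr_ge0// ltW.
Qed.

(** Agrees with the profile on [0, 1] and is continuous on the whole line. *)
Definition pdens_ext r : R := pvalue + 2 * j * pos (pedge - r).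

Lemma rhoM_pdens_ext r : 0 <= r <= 1 -> rhoM j M r = pdens_ext r.
Proof.
move=> r01; rewrite rhoM_pdens// /pdens /pdens_ext.
case: leP => rB; first by rewrite posE// subr_ge0.
rewrite pos0 ?subr_le0 ?ltW// mulr0 addr0.
case: pvalue_edge => [->//|B1]; move: r01 rB; rewrite B1; lra.
Qed.

Lemma continuous_pdens_ext : continuous pdens_ext.
Proof.
move=> r; apply: cvgD; first exact: cvg_cst.
apply: cvgMr; apply: (@continuous_max R R (fun r => pedge - r) (fun=> 0)).
  by apply: cvgB; [exact: cvg_cst|exact: cvg_id].
exact: cvg_cst.
Qed.

Lemma ptail_out r : pedge <= r -> ptail r = 0.
Proof. by move=> Br; rewrite /ptail pos0 ?subr_le0// mulr0 expr0n mulr0 addr0. Qed.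

Lemma ptail_ge1 r : 1 <= r -> ptail r = 0.
Proof. by move=> r1; apply: ptail_out; have /andP[_ /le_trans] := pedge_itv; exact. Qed.

Lemma ptail_ge0 r : 0 <= ptail r.
Proof. by rewrite addr_ge0 ?mulr_ge0 ?pvalue_ge0 ?pos_ge0 ?sqr_ge0// ltW. Qed.

Lemma ptail_gt0 r : (0 < ptail r) = (r < pedge).
Proof.
apply/idP/idP => [|rB]; first by apply: contraTT; rewrite -!leNgt => /ptail_out->.
rewrite ltr_wpDl ?mulr_ge0 ?pvalue_ge0 ?pos_ge0//.
by rewrite posE ?subr_ge0 ?ltW// mulr_gt0// exprn_gt0// subr_gt0.
Qed.

Definition plip : R := pvalue + 2 * j.

Lemma plip_gt0 : 0 < plip.
Proof. by rewrite ltr_wpDl ?pvalue_ge0// mulr_gt0. Qed.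

Lemma ptail_itv p q : 0 <= p -> p <= q -> 0 <= ptail p - ptail q <= plip * (q - p).
Proof.
move=> p0 pq; rewrite /ptail /plip.
have /andP[B0 B1] := pedge_itv; have A0 := pvalue_ge0; have j0 := j_gt0.
have u0 := pos_ge0 (pedge - q).
have uv : pos (pedge - q) <= pos (pedge - p) <= pos (pedge - q) + (q - p).
  by rewrite /pos; case: (leP (pedge - q) 0) => ?; case: (leP (pedge - p) 0) => ?; lra.
have v1 : pos (pedge - p) <= 1 by rewrite /pos; case: (leP (pedge - p) 0) => ?; lra.
move: (pos (pedge - q)) (pos (pedge - p)) u0 uv v1 => u v u0 /andP[uv1 uv2] v1.
have -> : pvalue * v + j * v ^+ 2 - (pvalue * u + j * u ^+ 2) =
  pvalue * (v - u) + j * ((v - u) * (v + u)) by ring.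
have d0 : 0 <= v - u by lra.
have A : 0 <= (v - u) * (v + u) <= 2 * (q - p) by apply/andP; split; nra.
apply/andP; split; first by rewrite addr_ge0// mulr_ge0//; [exact: ltW|lra].
rewrite [leRHS]mulrDl lerD//; first by apply: ler_wpM2l => //; lra.
have -> : 2 * j * (q - p) = j * (2 * (q - p)) by ring.
by rewrite ler_pM2l//; lra.
Qed.

Lemma ptail0 : ptail 0 = M.
Proof.
have /andP[B0 _] := pedge_itv.
rewrite /ptail subr0 posE// /pedge /pvalue; case: ltP => Mj.
  rewrite mul0r add0r sqr_sqrtr; last by rewrite divr_ge0// ltW.
  by rewrite mulrC divfK// gt_eqF.
by rewrite mulr1 expr1n mulr1 subrK.
Qed.

Lemma Rintegral_pdens_ext_below p q : p <= q -> q <= pedge ->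
  \int[mu]_(s in `[p, q]) pdens_ext s = ptail p - ptail q.
Proof.
move=> pq qB; pose F s := - (pvalue * (pedge - s) + j * (pedge - s) ^+ 2).
pose f s := pvalue + 2 * j * (pedge - s).
have dF (x : R) : is_derive x (1 : R) F (f x).
  rewrite /F /f; apply: is_derive_eq; rewrite /GRing.scale/=; ring.
have cf : continuous f.
  have df (x : R) : derivable f x (1 : R) by rewrite /f; exact: ex_derive.
  by move=> x; apply/differentiable_continuous/derivable1_diffP.
transitivity (\int[mu]_(s in `[p, q]) f s).
  apply: eq_Rintegral => s; rewrite inE/= in_itv/= => /andP[ps sq].
  by rewrite /pdens_ext posE// subr_ge0 (le_trans sq).
rewrite (Rintegral_FTC2 pq dF cf) /F /ptail !posE ?subr_ge0 ?(le_trans pq)//; ring.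
Qed.

Lemma Rintegral_pdens_ext_above p q : pedge <= p -> p <= q -> pvalue = 0 ->
  \int[mu]_(s in `[p, q]) pdens_ext s = 0.
Proof.
move=> Bp pq A0; transitivity (\int[mu]_(s in `[p, q]) (0 : R)).
  apply: eq_Rintegral => s; rewrite inE/= in_itv/= => /andP[ps _].
  by rewrite /pdens_ext A0 add0r pos0 ?mulr0// subr_le0 (le_trans Bp).
by rewrite Rintegral_cst// mul0r.
Qed.

Lemma Rintegral_rhoM p q : 0 <= p -> p <= q -> q <= 1 ->
  \int[mu]_(s in `[p, q]) rhoM j M s = ptail p - ptail q.
Proof.
move=> p0 pq q1; transitivity (\int[mu]_(s in `[p, q]) pdens_ext s).
  apply: eq_Rintegral => s; rewrite inE/= in_itv/= => /andP[ps sq].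
  by apply: rhoM_pdens_ext; rewrite (le_trans p0)//= (le_trans sq).
have [qB|Bq] := leP q pedge; first exact: Rintegral_pdens_ext_below.
have A0 : pvalue = 0 by case: pvalue_edge => // B1; move: Bq; rewrite B1; lra.
have [Bp|pB] := leP pedge p.
  by rewrite Rintegral_pdens_ext_above// !ptail_out ?subrr// ltW.
have := @Rintegral_itvB R pdens_ext (BLeft p) (BRight q) pedge
  (continuous_integrable_itv p q continuous_pdens_ext).
rewrite !bnd_simp => /(_ (ltW pB) (ltW Bq)).
rewrite Rintegral_itv_obnd_cbnd; last first.
  apply: integrableS (continuous_integrable_itv pedge q continuous_pdens_ext) => //.
  exact: subset_itv_oc_cc.
rewrite (Rintegral_pdens_ext_above (lexx _) (ltW Bq) A0).
rewrite (Rintegral_pdens_ext_below (ltW pB) (lexx _)).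
by move/eqP; rewrite subr_eq0 => /eqP ->; rewrite (ptail_out (lexx pedge)) (ptail_out (ltW Bq)).
Qed.

Lemma Fc_rhoM r : 0 <= r <= 1 -> Fc r (rhoM j M) = ptail r.
Proof. by move=> /andP[r0 r1]; rewrite /Fc Rintegral_rhoM// (ptail_ge1 (lexx 1)) subr0. Qed.

Lemma Ac_rhoM l N x : (0 < N)%N -> (x <= N)%N ->
  Ac l N x (rhoM j M) =
  N%:R / l%:R * (ptail (x%:R / N%:R) - ptail ((x + l)%:R / N%:R)).
Proof.
move=> N0 xN; rewrite /Ac; congr (_ * _).
have N0' : 0 < N%:R :> R by rewrite ltr0n.
have x1 : x%:R / N%:R <= 1 :> R by rewrite ler_pdivrMr// mul1r ler_nat.
have x0 : 0 <= x%:R / N%:R :> R by rewrite divr_ge0.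
have xl : x%:R / N%:R <= (x + l)%:R / N%:R :> R.
  by rewrite ler_pM2r ?invr_gt0// ler_nat leq_addr.
have [q1|q1] := leP ((x + l)%:R / N%:R) (1 : R).
  rewrite setIidl ?Rintegral_rhoM// => s /=; rewrite !in_itv/= => /andP[s1 s2].
  by rewrite (le_trans x0)//= (le_trans s2).
have -> : (`[(x%:R / N%:R)%R, ((x + l)%:R / N%:R)%R] `&` `[0%R, 1%R] =
    `[(x%:R / N%:R)%R, 1%R] :> set R)%classic.
  apply/seteqP; split=> s /=; rewrite !in_itv/=.
    by move=> [/andP[-> _] /andP[_ ->]].
  move=> /andP[s1 s2]; rewrite s1 s2 (le_trans x0 s1)/=; split=> //.
  by rewrite (le_trans s2)// ltW.
by rewrite Rintegral_rhoM// (ptail_ge1 (lexx 1)) (ptail_ge1 (ltW q1)).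
Qed.

Lemma is_edge_rhoM r : is_edge (rhoM j M) r -> pvalue = 0 /\ r = pedge.
Proof.
move=> [[/andP[r0 r1] rho0] rmin]; have /andP[B0 B1] := pedge_itv.
have Br : pedge <= r.
  rewrite leNgt; apply/negP => rB; have := rho0 r; rewrite lexx r1 => /(_ isT).
  rewrite rhoM_pdens ?r0// /pdens (ltW rB) => e.
  have : 0 < 2 * j * (pedge - r) by rewrite !mulr_gt0// subr_gt0.
  have := pvalue_ge0; lra.
have A0 : pvalue = 0.
  case: pvalue_edge => // e1; have := rho0 1; rewrite lexx r1 => /(_ isT).
  by rewrite rhoM_pdens ?ler01 ?lexx// /pdens e1 lexx subrr mulr0 addr0.
split=> //; apply/eqP; rewrite eq_le Br andbT; apply: rmin.
split=> [|r' /andP[Br' r'1]]; first by rewrite B0.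
rewrite rhoM_pdens ?(le_trans B0)// /pdens A0 add0r.
by case: leP => // r'B; have -> : pedge - r' = 0 by [lra]; rewrite mulr0.
Qed.

Variable N : nat.
Hypothesis N_gt0 : (0 < N)%N.

Definition gfloor : nat := Num.truncn (N%:R * pedge).
(** With z = gfloor - x, the quadratic (z + 1)(A + (j/N) z): second difference 2j/N, zero at z = -1.
    Being an exact discrete solution rather than a sampling of the continuum profile, it leaves no
    consistency error in the drift. *)
Definition gprof x : R :=
  if (x <= gfloor)%N then
    ((gfloor - x)%:R + 1) * (pvalue + j / N%:R * (gfloor - x)%:R)
  else 0.

Let Npos : 0 < N%:R :> R. Proof. by rewrite ltr0n. Qed.

Lemma gfloor_itv : gfloor%:R <= N%:R * pedge < gfloor%:R + 1.
Proof.
have /andP[B0 _] := pedge_itv.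
by rewrite natr1; apply: truncn_itv; rewrite mulr_ge0// ltW.
Qed.

Lemma gfloor_le : (gfloor <= N)%N.
Proof.
have /andP[g1 _] := gfloor_itv; have /andP[B0 B1] := pedge_itv.
by rewrite -(ler_nat R) (le_trans g1)// ler_piMr.
Qed.

Lemma gprof_ge0 x : 0 <= gprof x.
Proof.
rewrite /gprof; case: ifP => // _.
by rewrite mulr_ge0 ?addr_ge0 ?pvalue_ge0 ?mulr_ge0 ?divr_ge0// ltW.
Qed.

Lemma gprof_le x : gprof x <= gprof 0.
Proof.
have j0 : 0 <= j / N%:R by rewrite divr_ge0// ltW.
rewrite {1}/gprof; case: ifP => [xg|_]; last exact: gprof_ge0.
rewrite /gprof leq0n subn0.
have h : (gfloor - x)%:R <= gfloor%:R :> R by rewrite ler_nat leq_subr.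
apply: ler_pM.
- by rewrite addr_ge0.
- by rewrite addr_ge0 ?pvalue_ge0// mulr_ge0.
- by rewrite lerD2r.
- by rewrite lerD2l ler_wpM2l.
Qed.

Lemma gprof_out x : (gfloor.+1 <= x)%N -> gprof x = 0.
Proof. by rewrite /gprof ltnNge => /negbTE ->. Qed.

Lemma gprof_last : gprof N.+1 = 0.
Proof. by rewrite gprof_out// ltnS gfloor_le. Qed.

Lemma gprof_laplace x : (0 < x <= N)%N ->
  gprof x.-1 - 2 * gprof x + gprof x.+1 = 2 * (j / N%:R) * (x < gfloor.+1)%:R.
Proof.
case: x => // x /= xN; rewrite ltnS.
have [xg|gx] := leqP x.+1 gfloor.
  rewrite /gprof xg (ltnW xg)/=.
  have -> : (gfloor - x)%:R = (gfloor - x.+1)%:R + 1 :> R by rewrite natr1 subnSK.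
  have [xg2|gx2] := leqP x.+2 gfloor.
    have -> : (gfloor - x.+1)%:R = (gfloor - x.+2)%:R + 1 :> R by rewrite natr1 subnSK.
    ring.
  have -> : (gfloor - x.+1 = 0)%N by lia.
  ring.
rewrite mulr0 (gprof_out gx) (gprof_out (leqW gx)) mulr0 subr0 addr0 /gprof.
(* At the first site past the edge the equation needs G to vanish one site earlier. It does when A =
   0; otherwise B = 1, [gfloor] is N, and that site is out of range. *)
case: leqP => // xg; have e : gfloor = x by lia.
have A0 : pvalue = 0.
  case: pvalue_edge => // B1; exfalso.
  have /andP[_] := gfloor_itv; rewrite B1 mulr1 natr1 ltr_nat e; lia.
by rewrite e subnn A0 mulr0 addr0 mulr0.
Qed.

(** Both rounding the edge and replacing y^2 by z(z + 1) cost O(1) uniformly in N. *)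
Lemma gprof_near x : `|gprof x - N%:R * ptail (x%:R / N%:R)| <= plip.
Proof.
have /andP[g1 g2] := gfloor_itv; have /andP[B0 B1] := pedge_itv.
have A0 := pvalue_ge0; have j0 := j_gt0.
have [xg|gx] := leqP x gfloor; last first.
  have h : pedge <= x%:R / N%:R.
    by rewrite ler_pdivlMr// mulrC (le_trans (ltW g2))// natr1 ler_nat.
  by rewrite gprof_out// (ptail_out h) mulr0 subrr normr0 ltW// plip_gt0.
rewrite /gprof xg.
set z := (gfloor - x)%:R : R.
set y := N%:R * pedge - x%:R.
have ze : z = gfloor%:R - x%:R by rewrite /z natrB.
have zy : z <= y < z + 1 by rewrite ze /y; lra.
have z0 : 0 <= z by [].
have zN : z <= N%:R by rewrite ler_nat (leq_trans (leq_subr _ _)) ?gfloor_le.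
have N1 : 1 <= N%:R :> R by rewrite ler1n.
have ey : pedge - x%:R / N%:R = y / N%:R by rewrite /y; field; rewrite gt_eqF.
rewrite /ptail ey posE; last by rewrite divr_ge0//; lra.
have -> : (z + 1) * (pvalue + j / N%:R * z) -
    N%:R * (pvalue * (y / N%:R) + j * (y / N%:R) ^+ 2) =
    pvalue * (z + 1 - y) + j * ((z ^+ 2 + z - y ^+ 2) / N%:R).
  by field; rewrite gt_eqF.
have H : `|(z ^+ 2 + z - y ^+ 2) / N%:R| <= 2.
  rewrite normrM normfV (gtr0_norm Npos) ler_pdivrMr//.
  by rewrite ler_norml; apply/andP; split; nra.
rewrite (le_trans (ler_normD _ _))// /plip lerD//.
  rewrite normrM (ger0_norm A0) ler_piMr// ler_norml; lra.
by rewrite normrM (gtr0_norm j_gt0) mulrC ler_wpM2r// ltW.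
Qed.

End Profile.

(** * From the Lyapunov functional to uniform closeness *)

(** By finite propagation the lower bound survives on the block shortened by k at each end. *)
Lemma dot_iter_dsm_lower {R : realType} (N k p L : nat) (f : nat -> R) (v : R) :
  (0 < p)%N -> (p + L <= N)%N -> 0 <= v ->
  (forall x, (p <= x <= p + L)%N -> v <= f x) ->
  (L - 2 * k)%:R * v ^+ 2 <= dot N (iter k (dsm N) f) (iter k (dsm N) f).
Proof.
move=> p0 pL v0 fv.
have [Lk|kL] := leqP L (2 * k).
  rewrite (eqP (_ : (L - 2 * k)%N == 0%N)) ?subn_eq0// mul0r sumr_ge0// => x _.
  by rewrite -expr2 sqr_ge0.
have q0 x : 0 <= iter k (dsm N) f x * iter k (dsm N) f x by rewrite -expr2 sqr_ge0.
have a1 : (1 <= p + k)%N by lia.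
have a2 : (p + k <= N.+1)%N by lia.
have b1 : (p + k <= p + L - k)%N by lia.
have b2 : (p + L - k <= N.+1)%N by lia.
rewrite /dot (big_cat_nat a1 a2)/= (big_cat_nat b1 b2)/=.
rewrite ler_wpDl ?sumr_ge0// ler_wpDr ?sumr_ge0//.
have -> : (L - 2 * k)%:R * v ^+ 2 = \sum_(p + k <= x < p + L - k) v ^+ 2.
  rewrite sumr_const_nat mulr_natl; congr (_ *+ _); lia.
rewrite [leLHS]big_nat [leRHS]big_nat; apply: ler_sum => x /andP[px xL].
have h : v <= iter k (dsm N) f x by apply: (iter_dsm_ge p0 pL fv); lia.
by rewrite expr2 ler_pM.
Qed.

Section Closeness.
Context {R : realType} (j M : R).
Hypotheses (j_gt0 : 0 < j) (M_ge0 : 0 <= M).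
Variable N : nat.
Hypothesis N_gt0 : (0 < N)%N.
Notation C := (plip j M).
Notation G := (gprof j M N).
Implicit Types (xi : conf N) (x l k : nat).

Let Npos : 0 < N%:R :> R. Proof. by rewrite ltr0n. Qed.

Definition pt x : R := N%:R * ptail j M (x%:R / N%:R).

Definition discr xi x : R := tail xi x - pt x.

Lemma pt_itv x y : (x <= y)%N -> 0 <= pt x - pt y <= C * (y%:R - x%:R).
Proof.
move=> xy.
have /andP[h1 h2] : 0 <= ptail j M (x%:R / N%:R) - ptail j M (y%:R / N%:R) <=
    C * (y%:R / N%:R - x%:R / N%:R).
  by apply: ptail_itv; rewrite ?divr_ge0// ler_pM2r ?invr_gt0// ler_nat.
rewrite /pt -mulrBr mulr_ge0//=; apply: le_trans (ler_wpM2l (ltW Npos) h2) _.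
by rewrite le_eqVlt; apply/orP; left; apply/eqP; field; rewrite gt_eqF.
Qed.

Lemma pt_ge0 x : 0 <= pt x.
Proof. by rewrite mulr_ge0// ptail_ge0. Qed.

Lemma pt_out x : (N <= x)%N -> pt x = 0.
Proof. by move=> Nx; rewrite /pt ptail_ge1 ?mulr0// ler_pdivlMr// mul1r ler_nat. Qed.

Lemma Ad_tail l x xi : (0 < l)%N -> (x + l <= N.+1)%N ->
  l%:R * Ad R l x xi = tail xi x - tail xi (x + l).
Proof.
move=> l0 xl; rewrite /Ad mulrA mulfV ?pnatr_eq0 -?lt0n// mul1r /tail.
by rewrite (big_cat_nat (leq_addr l x) xl)/= addrK.
Qed.

Lemma Ac_pt l x : (0 < l)%N -> (x <= N)%N ->
  l%:R * Ac l N x (rhoM j M) = pt x - pt (x + l).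
Proof.
move=> l0 xN; rewrite Ac_rhoM// /pt; field.
by rewrite pnatr_eq0 -lt0n.
Qed.

Lemma discr_window l x xi (tau : R) : (0 < l)%N -> (x + l <= N.+1)%N ->
  `|Ad R l x xi - Ac l N x (rhoM j M)| <= tau ->
  `|discr xi x - discr xi (x + l)| <= l%:R * tau.
Proof.
move=> l0 xl H.
have -> : discr xi x - discr xi (x + l) = l%:R * (Ad R l x xi - Ac l N x (rhoM j M)).
  rewrite mulrBr Ad_tail// Ac_pt//; last lia.
  rewrite /discr; ring.
by rewrite normrM ger0_norm// ler_wpM2l.
Qed.

(** Windows are chained from the right end, where the discrepancy is 0: each adds [l * tau], in
    total at most (N + 1) tau. The incomplete window costs l (1 + C). *)
Lemma discr_initial l xi (tau : R) : (0 < l)%N -> (l <= N.+1)%N -> 0 <= tau <= 1 ->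
  (forall x, (x + l <= N.+1)%N -> `|Ad R l x xi - Ac l N x (rhoM j M)| <= tau) ->
  forall x, (x <= N.+1)%N -> `|discr xi x| <= N.+1%:R * tau + l%:R * (1 + C).
Proof.
move=> l0 lN /andP[t0 t1] H.
have C0 := plip_gt0 M j_gt0.
have l0' := ler0n R l.
suff S n x : (x <= N.+1)%N -> (N.+1 - x <= n)%N ->
    `|discr xi x| <= (N.+1 - x)%:R * tau + l%:R * (1 + C).
  move=> x xN; apply: le_trans (S N.+1 x xN _) _; first by rewrite leq_subr.
  by rewrite lerD2r ler_wpM2r// ler_nat leq_subr.
elim: n x => [|n IH] x xN xn.
  have -> : x = N.+1 by lia.
  rewrite subnn mul0r add0r /discr tail_out// pt_out// subrr normr0.
  by rewrite mulr_ge0// addr_ge0// ltW.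
have [xl|xl] := leqP (x + l) N.+1.
  have h1 := discr_window l0 xl (H x xl).
  have := IH (x + l)%N xl; have -> : (N.+1 - (x + l) <= n)%N by lia.
  move=> /(_ isT) h2.
  have -> : discr xi x = (discr xi x - discr xi (x + l)) + discr xi (x + l) by ring.
  apply: le_trans (ler_normD _ _) _.
  have -> : (N.+1 - x)%:R = l%:R + (N.+1 - (x + l))%:R :> R.
    by rewrite -natrD; congr (_%:R); move: xl; clear; lia.
  lra.
(* Fewer than [l] sites remain: [x] lies in the last full window, and monotonicity of F and of the
   profile bounds the discrepancy by the content of that window. *)
pose x0 := (N.+1 - l)%N.
have x0l : (x0 + l = N.+1)%N by rewrite /x0 subnK.
have h := discr_window l0 (eq_leq x0l) (H x0 (eq_leq x0l)).
rewrite x0l {2}/discr tail_out// pt_out// subrr subr0 in h.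
have x0x : (x0 <= x)%N by lia.
have T := tail_le (R := R) xi x0x.
have T0 := tail_ge0 (R := R) xi x.
have /andP[P1 _] := pt_itv x0x.
have x0N : (x0 <= N)%N by rewrite -ltnS -x0l -addn1 leq_add2l.
have /andP[_ P2] := pt_itv x0N.
have P0 := pt_ge0 x.
rewrite (pt_out (leqnn N)) subr0 in P2.
have P3 : C * (N%:R - x0%:R) <= C * l%:R.
  apply: ler_wpM2l; first exact: ltW.
  by rewrite lerBlDr -natrD ler_nat addnC x0l leqnSn.
have lt : l%:R * tau <= l%:R by rewrite ler_piMr.
move: h; rewrite /discr ler_norml => /andP[_ h].
apply: (@le_trans _ _ (l%:R * (1 + C))); last first.
  by rewrite lerDr mulr_ge0.
rewrite ler_norml; apply/andP; split; lra.
Qed.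

Notation PhiG k := (@Phi R N k G).
Notation excess := (@excess R N G).
Notation height := (@height R N G).

Lemma discr_height xi x : (x <= N.+1)%N ->
  `|height xi x - discr xi x| <= C + `|excess xi|.
Proof.
move=> xN; have /andP[l0 l1] := @lin_itv R N x xN.
have g := gprof_near M j_gt0 N_gt0 x.
have -> : height xi x - discr xi x = - (G x - pt x) - excess xi * lin N x.
  rewrite /height /discr; ring.
rewrite (le_trans (ler_normB _ _))// normrN lerD// normrM (ger0_norm l0).
by rewrite ler_piMr.
Qed.

Lemma discr0_excess xi : `|discr xi 0 - excess xi| <= C.
Proof.
have g := gprof_near M j_gt0 N_gt0 0.
have -> // : discr xi 0 - excess xi = G 0%N - pt 0.
rewrite /discr /excess; ring.
Qed.

Lemma Phi_initial_le k xi (D : R) : 0 <= D ->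
  (forall x, (x <= N.+1)%N -> `|discr xi x| <= D) ->
  `|excess xi| <= D + C /\ PhiG k xi <= N%:R * (2 * (D + C)) ^+ 2.
Proof.
move=> D0 HD; have C0 := plip_gt0 M j_gt0.
have m1 : `|excess xi| <= D + C.
  have -> : excess xi = discr xi 0 - (discr xi 0 - excess xi) by ring.
  by rewrite (le_trans (ler_normB _ _))// lerD ?HD ?discr0_excess.
split=> //.
have hh x : (x <= N.+1)%N -> `|height xi x| <= 2 * (D + C).
  move=> xN; have -> : height xi x = (height xi x - discr xi x) + discr xi x by ring.
  apply: le_trans (ler_normD _ _) _.
  have := HD x xN; have := discr_height xi xN; move: m1; lra.
have E0 : 0 <= 2 * (D + C) by lra.
rewrite /Phi /dot.
have -> : N%:R * (2 * (D + C)) ^+ 2 = \sum_(1 <= x < N.+1) (2 * (D + C)) ^+ 2.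
  by rewrite sumr_const_nat subSS subn0 mulr_natl.
rewrite [leLHS]big_nat [leRHS]big_nat; apply: ler_sum => x /andP[_ xN].
have := dsm_norm_le E0 hh k (ltnW xN); rewrite ler_norml => /andP[].
by nra.
Qed.

(** One-sided regularity from F monotone and the profile Lipschitz: a positive discrepancy persists
    to the left, a negative one to the right. *)
Lemma discr_le_left xi x y : (x <= y)%N ->
  discr xi y - C * (y%:R - x%:R) <= discr xi x.
Proof.
move=> xy; have /andP[_ h] := pt_itv xy; have := tail_le (R := R) xi xy.
rewrite /discr; lra.
Qed.

(** A deviation [z] persists over L sites up to the loss z/4, and passing to [height] loses z/4
    more, so |h| >= z/2 on a block. *)
Lemma Phi_lower k L xi x0 (z : R) : (x0 <= N)%N -> 0 < z ->
  C * L%:R <= z / 4 -> C + `|excess xi| <= z / 4 -> z < `|discr xi x0| ->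
  (L - 2 * k - 1)%:R * (z / 2) ^+ 2 <= PhiG k xi.
Proof.
move=> x0N z0 CL Cm H; have C0 := plip_gt0 M j_gt0.
have z2 : 0 <= z / 2 by lra.
have Cmono (u v : nat) : (u <= v)%N -> (v - u <= L)%N -> C * (v%:R - u%:R) <= z / 4.
  move=> uv vu; apply: le_trans CL; apply: ler_wpM2l; first exact: ltW.
  by rewrite -natrB// ler_nat.
have w x : (x <= N.+1)%N -> discr xi x - z / 4 <= height xi x <= discr xi x + z / 4.
  by move=> xN; have := discr_height xi xN; rewrite ler_norml => /andP[h1 h2];
    apply/andP; split; lra.
have [e0|e0] := lerP 0 (discr xi x0).
  rewrite ger0_norm// in H.
  (* There is room on the left: near 0 the discrepancy is close to the excess, which is too
     small. *)
  have Lx : (L < x0)%N.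
    rewrite ltnNge; apply/negP => xL.
    have := discr_le_left xi (leq0n x0); have := Cmono 0%N x0 (leq0n _).
    rewrite subn0 => /(_ xL) h1 h2.
    have := discr0_excess xi; rewrite ler_norml => /andP[_ h3].
    have := ler_norm (excess xi); lra.
  apply: (@le_trans _ _ ((L - 2 * k)%:R * (z / 2) ^+ 2)).
    by rewrite ler_wpM2r ?sqr_ge0// ler_nat leq_subr.
  apply: (@dot_iter_dsm_lower _ _ _ (x0 - L)%N) => //.
  - by rewrite subn_gt0.
  - by rewrite subnK// ltnW.
  - rewrite subnK ?(ltnW Lx)// => x /andP[x1 x2].
    have := discr_le_left xi x2; have := Cmono x x0 x2.
    have -> : (x0 - x <= L)%N by move: x1; clear; lia.
    move=> /(_ isT) h1 h2.
    have /w/andP[h3 _] := leqW (leq_trans x2 x0N).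
    lra.
rewrite ltr0_norm// in H.
(* There is room on the right because the discrepancy vanishes at N + 1. *)
have Lx : (x0 + L <= N)%N.
  rewrite leqNgt; apply/negP => xL.
  have := @discr_le_left xi x0 N.+1; have := Cmono x0 N.+1.
  have -> : (x0 <= N.+1)%N by exact: leqW.
  have -> : (N.+1 - x0 <= L)%N by move: xL; clear; lia.
  move=> /(_ isT isT) h1 /(_ isT).
  rewrite {1}/discr tail_out// pt_out// subrr; lra.
(* This is -h, written so that linearity of smoothing applies as stated. *)
pose f x := height xi x + (-2) * height xi x.
have -> : PhiG k xi = dot N (iter k (dsm N) f) (iter k (dsm N) f).
  by rewrite /f iter_dsm_linear /dot; apply: eq_bigr => x _; ring.
have [L0|L0] := posnP L.
  rewrite L0 sub0n mul0r sumr_ge0// => x _; by rewrite -expr2 sqr_ge0.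
(* The block starts at x0 + 1, since x0 may be the boundary site 0; hence one site fewer. *)
have -> : (L - 2 * k - 1 = L.-1 - 2 * k)%N by clear; lia.
apply: (@dot_iter_dsm_lower _ _ _ x0.+1) => //.
- by move: Lx L0; clear; lia.
- move=> x /andP[x1 x2].
  have := @discr_le_left xi x0 x; have := Cmono x0 x.
  have -> : (x0 <= x)%N by exact: ltnW.
  have -> : (x - x0 <= L)%N by move: x2 L0; clear; lia.
  move=> /(_ isT isT) h1 /(_ isT) h2.
  have /w/andP[_ h3] : (x <= N.+1)%N by move: x2 Lx L0; clear; lia.
  rewrite /f; lra.
Qed.

End Closeness.

Lemma natrB_ge (R : realDomainType) (a b : nat) : a%:R - b%:R <= (a - b)%:R :> R.
Proof.
have [ab|/ltnW ba] := leqP a b; last by rewrite natrB.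
by rewrite (eqP (_ : (a - b)%N == 0%N)) ?subn_eq0// subr_le0 ler_nat.
Qed.

Lemma central_le1 (R : realType) n : central n <= 1 :> R.
Proof.
rewrite -(expr_le1 (_ : (0 < 2)%N))//; last exact: central_ge0.
rewrite (le_trans (central_sqr_le R n))// invf_le1 ?ltr0n ?addn1//.
by rewrite ler1n.
Qed.

(** * Quantitative concentration around the linear profile *)

Section ConcentrationAtProfile.
Context {R : realType} (j M : R).
Hypotheses (j_gt0 : 0 < j) (M_ge0 : 0 <= M).
Notation C := (plip j M).
Notation kappa k := (central (k + k) : R).

(** First term: N m^2 when |m| > zeta N / 8. Second: at least zeta N / (8C) sites where the smoothed
    height is at least zeta N / 2 in absolute value. Both are divided by N^3. *)
Definition threshold (zeta : R) : R := Num.min (zeta ^+ 2 / 64) (zeta ^+ 3 / (32 * C)).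

Lemma threshold_gt0 zeta : 0 < zeta -> 0 < threshold zeta.
Proof.
move=> z0; rewrite /threshold lt_min !divr_gt0 ?exprn_gt0 ?mulr_gt0 ?ltr0n//.
exact: plip_gt0.
Qed.

Lemma discr_threshold N k (xi : conf N) (zeta : R) : (0 < N)%N -> 0 < zeta ->
  2 * k%:R + 2 <= zeta * N%:R / (8 * C) -> C <= zeta * N%:R / 8 ->
  ~ (forall x, (x <= N)%N -> `|discr j M xi x| <= zeta * N%:R) ->
  threshold zeta * N%:R ^+ 3 <=
    Phi k (gprof j M N) xi + N%:R * excess (gprof j M N) xi ^+ 2.
Proof.
move=> N0 z0 Hk HC /existsNP[x /not_implyP[xN /negP]]; rewrite -ltNge => Hx.
have C0 := plip_gt0 M j_gt0.
have Npos : 0 < N%:R :> R by rewrite ltr0n.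
have zN : 0 < zeta * N%:R by rewrite mulr_gt0.
have Phi0 : 0 <= Phi k (gprof j M N) xi.
  by rewrite sumr_ge0// => y _; rewrite -expr2 sqr_ge0.
have [mle|mgt] := leP `|excess (gprof j M N) xi| (zeta * N%:R / 8); last first.
  rewrite ler_wpDl//.
  apply: (@le_trans _ _ (zeta ^+ 2 / 64 * N%:R ^+ 3)).
    by rewrite ler_pM2r ?exprn_gt0// /threshold ge_min lexx.
  have -> : zeta ^+ 2 / 64 * N%:R ^+ 3 = N%:R * (zeta * N%:R / 8) ^+ 2 by field.
  rewrite ler_pM2l// -(real_normK (num_real (excess (gprof j M N) xi))).
  by rewrite ler_pXn2r ?nnegrE ?normr_ge0 ?ltW// divr_gt0.
apply: (@le_trans _ _ (Phi k (gprof j M N) xi)); last first.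
  by rewrite lerDl mulr_ge0// sqr_ge0.
pose L := Num.truncn (zeta * N%:R / (4 * C)).
have q0 : 0 <= zeta * N%:R / (4 * C) by rewrite divr_ge0 ?ltW// mulr_gt0.
have /andP[L1 L2] := truncn_itv q0.
have CL : C * L%:R <= zeta * N%:R / 4.
  apply: le_trans (ler_wpM2l (ltW C0) L1) _.
  by rewrite le_eqVlt; apply/orP; left; apply/eqP; field; rewrite gt_eqF.
have Cm : C + `|excess (gprof j M N) xi| <= zeta * N%:R / 4 by lra.
have low := Phi_lower j_gt0 N0 k xN zN CL Cm Hx.
apply: le_trans low.
have Lk : zeta * N%:R / (8 * C) <= (L - 2 * k - 1)%:R.
  have h : L%:R - (2 * k%:R + 1) <= (L - 2 * k - 1)%:R :> R.
    by rewrite -subnDA -natrM natr1 -addn1 natrB_ge.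
  have -> : zeta * N%:R / (8 * C) = zeta * N%:R / (4 * C) - zeta * N%:R / (8 * C).
    by field; rewrite gt_eqF.
  rewrite -/L -[ltRHS]natr1 in L2; move: Hk h L2; lra.
apply: (@le_trans _ _ (zeta ^+ 3 / (32 * C) * N%:R ^+ 3)).
  by rewrite ler_pM2r ?exprn_gt0// /threshold ge_min lexx orbT.
have -> : zeta ^+ 3 / (32 * C) * N%:R ^+ 3 =
    zeta * N%:R / (8 * C) * (zeta * N%:R / 2) ^+ 2 by field; rewrite gt_eqF.
by rewrite ler_wpM2r// sqr_ge0.
Qed.

(** The error over N^3 is [error_slow] plus [error_cst] / N. Here [u] bounds the initial deviation
    over N, and 5 = 4 + 1 collects the initial [Phi] and N m^2. The slow part is small only by
    choice of [delta], [k] and [u]. *)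
Definition error_slow (delta t : R) k u : R :=
  u ^+ 2 * (5 + (6 * j + 1) * t / delta) +
  t * ((6 * j + 1) * delta + kappa k * (M + C)).

Definition error_cst (delta t : R) k : R :=
  t * (2 * j * k%:R * (M + C) + 2 * j * k%:R * j + 4 * j) +
  (6 * j + 1) * j * t ^+ 2 / delta.

Lemma probat_profile N k (xi : conf N) (zeta delta t u D : R) :
  (0 < N)%N -> (k <= N)%N -> 0 < zeta -> 0 < delta -> 0 <= t -> 0 <= D ->
  (forall x, (x <= N.+1)%N -> `|discr j M xi x| <= D) -> D + C <= u * N%:R ->
  2 * k%:R + 2 <= zeta * N%:R / (8 * C) -> C <= zeta * N%:R / 8 ->
  ((1 - (error_slow delta t k u + error_cst delta t k / N%:R) / threshold zeta)%R%:E <=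
   probat j xi (N%:R ^+ 2 * t)%R
     [set eta : conf N | forall x, (x <= N)%N -> (`|discr j M eta x| <= zeta * N%:R)%R])%E.
Proof.
move=> N0 kN z0 de0 t0 D0 HD Du Hk HC.
have C0 := plip_gt0 M j_gt0.
have Npos : 0 < N%:R :> R by rewrite ltr0n.
have c0 := threshold_gt0 z0.
have [m1 P1] := Phi_initial_le j_gt0 N0 k D0 HD.
set G := gprof j M N in m1 P1 *.
set c := threshold zeta in c0 *.
have u0 : 0 <= u by rewrite -(pmulr_lge0 _ Npos); lra.
have m2 : excess G xi ^+ 2 <= u ^+ 2 * N%:R ^+ 2.
  rewrite -exprMn -(real_normK (num_real (excess G xi))).
  by rewrite ler_pXn2r ?nnegrE ?normr_ge0 ?mulr_ge0 ?(ltW Npos)// (le_trans m1).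
have P2 : Phi k G xi <= 4 * u ^+ 2 * N%:R ^+ 3.
  apply: le_trans P1 _.
  have -> : 4 * u ^+ 2 * N%:R ^+ 3 = N%:R * (2 * (u * N%:R)) ^+ 2 by ring.
  have DC0 : 0 <= 2 * (D + C) by lra.
  have uN0 : 0 <= 2 * (u * N%:R) by rewrite !mulr_ge0.
  by rewrite ler_pM2l// ler_pXn2r// ler_pM2l.
have T0 : 0 <= N%:R ^+ 2 * t by rewrite mulr_ge0// sqr_ge0.
(* Young's scale: over a time N^2 t, a drift of order delta N yields delta N^3. *)
have d0 : 0 < delta * N%:R by rewrite mulr_gt0.
have K0 : 0 < c * N%:R ^+ 3 by rewrite mulr_gt0// exprn_gt0.
have main := @probat_ge_Phi R j N k (gfloor j M N).+1 G (ltW j_gt0) N0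
  (gprof_ge0 M j_gt0 N) (gprof_le M j_gt0 N) (@gprof_out R j M N)
  (gprof_last M j_gt0 N) (@gprof_laplace R j M j_gt0 M_ge0 N N0)
  (delta * N%:R) (c * N%:R ^+ 3) (N%:R ^+ 2 * t) xi _ T0 d0 K0
  (fun eta => @discr_threshold N k eta zeta N0 z0 Hk HC).
apply: le_trans main; rewrite lee_fin lerD2l lerN2.
have c3 : 0 < N%:R ^+ 3 :> R by rewrite exprn_gt0.
rewrite ler_pdivrMr// [leRHS]mulrA divfK ?gt_eqF//.
set B1 := drift_coef j N k.
have k0 := central_ge0 R (k + k); have k1 := central_le1 R (k + k).
have jk : j / N%:R * k%:R <= j.
  by rewrite mulrAC ler_pdivrMr// ler_pM2l// ler_nat.
have B10 : 0 <= B1 by exact/drift_coef_ge0/ltW.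
have B11 : B1 <= 6 * j + 1 by rewrite /B1 /drift_coef; lra.
have G0 : G 0%N <= (M + C) * N%:R.
  have := gprof_near M j_gt0 N0 0; rewrite mul0r ptail0// ler_norml => /andP[_ h].
  have : C <= C * N%:R by rewrite ler_peMr ?(ltW C0)// ler1n.
  rewrite /G; nra.
have j0 := j_gt0.
have MC : 0 <= M + C := addr_ge0 M_ge0 (ltW C0).
have jN : j / N%:R * N%:R = j by rewrite divfK// gt_eqF.
have drift : drift_cst j N k G (delta * N%:R) <= (6 * j + 1) * delta * N%:R +
    kappa k * (M + C) * N%:R + 2 * j * k%:R * (M + C) + 2 * j * k%:R * j + 2 * j.
  rewrite /drift_cst -/B1.
  have h1 : B1 * (delta * N%:R) <= (6 * j + 1) * (delta * N%:R) by rewrite ler_pM2r.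
  have h2 : (2 * (j / N%:R) * k%:R + kappa k) * G 0%N <=
      (2 * (j / N%:R) * k%:R + kappa k) * ((M + C) * N%:R).
    apply: ler_wpM2l => //.
    by rewrite addr_ge0// !mulr_ge0// ltW.
  have h3 : (2 * (j / N%:R) * k%:R + kappa k) * ((M + C) * N%:R) =
      2 * j * k%:R * (M + C) + kappa k * (M + C) * N%:R by field; rewrite gt_eqF.
  have h4 : 2 * (j / N%:R) * k%:R * j <= 2 * j * k%:R * j.
    have jN1 : j / N%:R <= j by rewrite ler_pdivrMr// ler_peMr ?ler1n// ltW.
    by rewrite ler_wpM2r ?(ltW j0)// ler_wpM2r// ler_wpM2l.
  move: h1 h2 h3 h4; lra.
have h5 : B1 / (delta * N%:R) * excess G xi ^+ 2 <=
    (6 * j + 1) / delta * u ^+ 2 * N%:R.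
  apply: (@le_trans _ _ ((6 * j + 1) / (delta * N%:R) * (u ^+ 2 * N%:R ^+ 2))).
    apply: ler_pM => //; first by rewrite divr_ge0// ltW.
      exact: sqr_ge0.
    by rewrite ler_pM2r// invr_gt0.
  by rewrite le_eqVlt; apply/orP; left; apply/eqP; field; rewrite !gt_eqF.
have h6 : B1 / (delta * N%:R) * (j / N%:R) * (N%:R ^+ 2 * t) ^+ 2 <=
    (6 * j + 1) * j * t ^+ 2 / delta * N%:R ^+ 2.
  apply: (@le_trans _ _ ((6 * j + 1) / (delta * N%:R) * (j / N%:R) * (N%:R ^+ 2 * t) ^+ 2)).
    rewrite ler_wpM2r ?sqr_ge0// ler_wpM2r ?divr_ge0 ?(ltW j0)//.
    by rewrite ler_pM2r// invr_gt0.
  by rewrite le_eqVlt; apply/orP; left; apply/eqP; field; rewrite !gt_eqF.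
have h7 := ler_wpM2r T0 (lerD (lerD h5 drift) (lexx (2 * j))).
have h8 := ler_wpM2l (ltW Npos) m2.
have e : (error_slow delta t k u + error_cst delta t k / N%:R) * N%:R ^+ 3 =
  4 * u ^+ 2 * N%:R ^+ 3 + N%:R * (u ^+ 2 * N%:R ^+ 2) +
  ((6 * j + 1) / delta * u ^+ 2 * N%:R + ((6 * j + 1) * delta * N%:R +
    kappa k * (M + C) * N%:R + 2 * j * k%:R * (M + C) + 2 * j * k%:R * j + 2 * j) + 2 * j)
    * (N%:R ^+ 2 * t) + (6 * j + 1) * j * t ^+ 2 / delta * N%:R ^+ 2.
  by rewrite /error_slow /error_cst; field; rewrite !gt_eqF.
rewrite e; exact: lerD (lerD (lerD P2 h8) h7) h6.
Qed.

End ConcentrationAtProfile.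

(** * The limit *)

Section Asymptotics.
Context {R : realType}.

Lemma near_invn_le (e : R) : 0 < e -> \forall N \near \oo, (0 < N)%N /\ (N%:R : R)^-1 <= e.
Proof.
move=> e0; exists (Num.truncn e^-1).+1 => // N /= eN.
have N0 : (0 < N)%N by exact: leq_trans eN.
split=> //; rewrite invf_ple ?posrE ?ltr0n//.
by rewrite ltW// (lt_le_trans (truncnS_gt _))// ler_nat.
Qed.

Lemma near_powR_invn_le (c e : R) : 0 < c -> 0 < e ->
  \forall N \near \oo, (N%:R : R)^-1 `^ c <= e.
Proof.
move=> c0 e0; have e1 : 0 < e `^ c^-1 by exact: powR_gt0.
near=> N.
have [N0 h] : (0 < N)%N /\ (N%:R : R)^-1 <= e `^ c^-1 by near: N; exact: near_invn_le.
have -> : e = (e `^ c^-1) `^ c by rewrite -powRrM mulVf ?gt_eqF// powRr1// ltW.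
by rewrite ge0_ler_powR// ?ltW// nnegrE ?invr_ge0// ltW.
Unshelve. all: by end_near. Qed.

Lemma ell_itv (b : R) N : 0 < b < 1 -> (0 < N)%N ->
  [/\ (0 < ell b N)%N, (ell b N <= N)%N &
      (ell b N)%:R <= N%:R * (N%:R : R)^-1 `^ (1 - b)].
Proof.
move=> /andP[b0 b1] N0; rewrite /ell.
have N1 : 1 <= N%:R :> R by rewrite ler1n.
have Nb : 1 <= (N%:R : R) `^ b.
  have e1 : (1 : R) `^ b = 1 by rewrite powR1.
  by rewrite -[leLHS]e1 ge0_ler_powR ?nnegrE// ltW.
have /andP[l1 l2] := truncn_itv (le_trans ler01 Nb).
have lb : (N%:R : R) `^ b <= N%:R.
  by rewrite -[leRHS]powRr1// ler_powR// ltW.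
split.
- by rewrite truncn_ge_nat// (le_trans ler01 Nb).
- by rewrite -(ler_nat R) (le_trans l1).
- rewrite (le_trans l1)// -powR_inv1// -powRrM mulN1r opprB.
  rewrite -[X in X * _]powRr1// -powRD; last by rewrite pnatr_eq0 -lt0n N0 implybT.
  by rewrite addrC subrK.
Qed.

End Asymptotics.

(** * Convergence for approximating initial configurations *)

Section HydrodynamicLimit.
Context {R : realType} (j M : R).
Hypotheses (j_gt0 : 0 < j) (M_ge0 : 0 <= M).
Notation C := (plip j M).

Definition profile_event N (zeta : R) : set (conf N) :=
  [set eta | forall x : 'I_N.+1,
    `|(N%:R)^-1 * (Fd x eta)%:R - Fc (x%:R / N%:R) (rhoM j M)| <= zeta].

Arguments profile_event N zeta : clear implicits.

Lemma profile_eventE N (zeta : R) : (0 < N)%N -> profile_event N zeta =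
  [set eta : conf N | forall x, (x <= N)%N -> `|discr j M eta x| <= zeta * N%:R].
Proof.
move=> N0; have Npos : 0 < N%:R :> R by rewrite ltr0n.
have key (eta : conf N) (x : 'I_N.+1) :
    (`|(N%:R)^-1 * (Fd x eta)%:R - Fc (x%:R / N%:R) (rhoM j M)| <= zeta) =
    (`|discr j M eta x| <= zeta * N%:R).
  have xN : (x <= N)%N by rewrite -ltnS.
  rewrite Fc_rhoM//; last first.
    by rewrite divr_ge0//= ler_pdivrMr// mul1r ler_nat.
  rewrite Fd_tail -ler_pdivrMr// -[in RHS](gtr0_norm Npos) -normf_div.
  by congr (`|_| <= _); rewrite /discr /pt; field; rewrite gt_eqF.
apply/seteqP; split=> eta /= H x.
  by move=> xN; have := H (Ordinal (xN : x < N.+1)%N); rewrite key.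
by rewrite key; apply: H; rewrite -ltnS.
Qed.

Lemma exists_central_le (e : R) : 0 < e -> exists k, central (k + k) <= e.
Proof.
move=> e0; pose k := Num.truncn (e ^+ 2)^-1; exists k.
have c0 := central_ge0 R (k + k).
rewrite -(ler_pXn2r (_ : (0 < 2)%N))// ?nnegrE ?(ltW e0)//.
apply: le_trans (central_sqr_le R (k + k)) _.
rewrite invf_ple ?posrE ?exprn_gt0 ?ltr0n ?addn1//.
rewrite ltW// (lt_le_trans (truncnS_gt _))// ler_nat -/k; lia.
Qed.

Lemma profile_event_near a b (xi : forall N, conf N) (zeta t e : R) :
  0 < a -> 0 < b < 1 -> approximates a b (rhoM j M) xi -> 0 < zeta -> 0 <= t -> 0 < e ->
  \forall N \near \oo,
    ((1 - e)%:E <= probat j (xi N) (N%:R ^+ 2 * t)%R (profile_event N zeta))%E.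
Proof.
move=> a0 b01 approx z0 t0 e0; have /andP[b0 b1] := b01.
have C0 := plip_gt0 M j_gt0; have c0 := threshold_gt0 M j_gt0 z0.
set c := threshold j M zeta in c0.
have ce : 0 < c * e by rewrite mulr_gt0.
have j0 := j_gt0.
have j6 : 0 < 6 * j + 1 by lra.
have MC : 0 <= M + C := addr_ge0 M_ge0 (ltW C0).
(* Each of four error terms gets c e / 4; [delta], [k] and [us] are fixed in this order before N.
   The + 1 covers t = 0. *)
pose delta := c * e / (4 * (t * (6 * j + 1) + 1)).
have td : 0 < t * (6 * j + 1) + 1 by rewrite ltr_wpDl// mulr_ge0// ltW.
have d0 : 0 < delta by rewrite divr_gt0// mulr_gt0.
have hd : t * ((6 * j + 1) * delta) <= c * e / 4.
  have -> : t * ((6 * j + 1) * delta) =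
    c * e / 4 * (t * (6 * j + 1) / (t * (6 * j + 1) + 1)).
    by rewrite /delta; field; rewrite gt_eqF.
  by rewrite ler_piMr ?divr_ge0 ?(ltW ce)// ler_pdivrMr// mul1r lerDl.
have tM : 0 < t * (M + C) + 1 by rewrite ltr_wpDl// mulr_ge0.
have [k hk] : exists k, central (k + k) <= c * e / (4 * (t * (M + C) + 1)).
  by apply: exists_central_le; rewrite divr_gt0// mulr_gt0.
have hk' : t * (central (k + k) * (M + C)) <= c * e / 4.
  have tMC : 0 <= t * (M + C) by rewrite mulr_ge0.
  have := ler_wpM2l tMC hk.
  have -> : t * (M + C) * (c * e / (4 * (t * (M + C) + 1))) =
    c * e / 4 * (t * (M + C) / (t * (M + C) + 1)) by field; rewrite gt_eqF.
  have : c * e / 4 * (t * (M + C) / (t * (M + C) + 1)) <= c * e / 4.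
    by rewrite ler_piMr ?divr_ge0 ?(ltW ce)// ler_pdivrMr// mul1r lerDl.
  move=> h1 h2; rewrite mulrCA mulrC; exact: le_trans h2 h1.
pose Z := 5 + (6 * j + 1) * t / delta.
have Z0 : 0 < Z by rewrite ltr_wpDr// divr_ge0 ?(ltW d0)// mulr_ge0// ltW.
pose W := error_cst j M delta t k.
have W0 : 0 <= W.
  apply: addr_ge0; last first.
    by apply: divr_ge0; [rewrite !mulr_ge0 ?sqr_ge0// ltW|exact: ltW].
  apply: mulr_ge0 => //; apply: addr_ge0; last by rewrite mulr_ge0// ltW.
  by apply: addr_ge0; rewrite !mulr_ge0// ltW.
(* The minimum with 1 gives us^2 <= us. *)
pose us := Num.min 1 (c * e / (4 * Z)).
have us0 : 0 < us by rewrite /us lt_min ltr01 divr_gt0// mulr_gt0.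
have k20 : 0 < 2 * k%:R + 2 :> R by rewrite ltr_wpDl// mulr_ge0.
have v1 : 0 < us / (3 * C) by rewrite divr_gt0// mulr_gt0.
have W1 : 0 < W + 1 := ltr_wpDl W0 ltr01.
have v2 : 0 < c * e / (4 * (W + 1)) by rewrite divr_gt0// mulr_gt0.
have v3 : 0 < zeta / (8 * C) by rewrite divr_gt0// mulr_gt0.
have v4 : 0 < zeta / (8 * C) / (2 * k%:R + 2) by rewrite divr_gt0.
have v5 : 0 < us / 6 by rewrite divr_gt0.
have C1 : 0 < 1 + C := addr_gt0 ltr01 C0.
have v6 : 0 < us / (3 * (1 + C)) by rewrite divr_gt0// mulr_gt0.
have v7 : 0 < 1 - b by rewrite subr_gt0.
apply: filterS (filterI
  (filterI (filterI (near_invn_le v1) (near_invn_le v2))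
           (filterI (near_invn_le v3) (near_invn_le v4)))
  (filterI (filterI (near_powR_invn_le a0 v5) (near_powR_invn_le v7 v6))
           (nbhs_infty_ge k))).
move=> N [[[[N0 hN1] [_ hN2]] [[_ hN3] [_ hN4]]] [[hN5 hN6] kN]].
have Npos : 0 < N%:R :> R by rewrite ltr0n.
have [l0 lN l1] := ell_itv b01 N0.
have tau01 : 0 <= (N%:R : R)^-1 `^ a <= 1.
  by rewrite powR_ge0/= (le_trans hN5)// (_ : us / 6 <= 1)//;
    have : us <= 1 by [rewrite /us ge_min lexx]; lra.
have HD := discr_initial j_gt0 M_ge0 N0 l0 (leqW lN) tau01 (approx N N0).1.
set tau := _ `^ a in tau01 hN5 HD.
set D := N.+1%:R * tau + (ell b N)%:R * (1 + C) in HD.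
have D0 : 0 <= D.
  by have /andP[? _] := tau01; rewrite addr_ge0// mulr_ge0// ltW.
(* One third of us N each for the chained windows, the incomplete window and the rounding constant
   C. *)
have Du : D + C <= us * N%:R.
  have h1 : N.+1%:R * tau <= us / 3 * N%:R.
    have : N.+1%:R * tau <= (2 * N%:R) * (us / 6).
      have /andP[? _] := tau01; apply: ler_pM => //.
      by rewrite -natrM ler_nat mul2n -addnn -addn1 leq_add2l.
    by have -> : us / 3 * N%:R = (2 * N%:R) * (us / 6) by field.
  have h2 : (ell b N)%:R * (1 + C) <= us / 3 * N%:R.
    have -> : us / 3 * N%:R = N%:R * (us / (3 * (1 + C))) * (1 + C).
      by field; rewrite gt_eqF.
    by rewrite ler_wpM2r ?(ltW C1)// (le_trans l1)// ler_wpM2l.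
  have h3 : C <= us / 3 * N%:R.
    move: hN1; rewrite invf_ple ?posrE ?divr_gt0 ?mulr_gt0// => h.
    have := ler_wpM2l (ltW (_ : 0 < us / 3)) h; rewrite divr_gt0// => /(_ isT).
    by have -> : us / 3 * (us / (3 * C))^-1 = C by field; rewrite !gt_eqF.
  rewrite /D; lra.
have H1 : 2 * k%:R + 2 <= zeta * N%:R / (8 * C).
  have := ler_wpM2l (ltW Npos) hN4; rewrite mulfV ?gt_eqF// => h.
  have := ler_wpM2l (ltW k20) h; rewrite mulr1.
  have -> // : (2 * k%:R + 2) * (N%:R * (zeta / (8 * C) / (2 * k%:R + 2))) =
    zeta * N%:R / (8 * C) by field; rewrite !gt_eqF.
have H2 : C <= zeta * N%:R / 8.
  have := ler_wpM2l (ltW Npos) hN3; rewrite mulfV ?gt_eqF// => h.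
  have := ler_wpM2l (ltW C0) h; rewrite mulr1.
  have -> // : C * (N%:R * (zeta / (8 * C))) = zeta * N%:R / 8 by field; rewrite gt_eqF.
rewrite profile_eventE//.
apply: le_trans (probat_profile j_gt0 M_ge0 N0 kN z0 d0 t0 D0 HD Du H1 H2).
rewrite lee_fin lerD2l lerN2 -/c ler_pdivrMr// [leRHS]mulrC.
have e1 : us ^+ 2 * Z <= c * e / 4.
  apply: (@le_trans _ _ (us * Z)).
    by rewrite ler_pM2r// expr2 ler_piMr ?(ltW us0)// /us ge_min lexx.
  have : us <= c * e / (4 * Z) by rewrite /us ge_min lexx orbT.
  by move=> /(ler_wpM2r (ltW Z0)); have -> : c * e / (4 * Z) * Z = c * e / 4
    by [field; rewrite gt_eqF].
have e2 : W / N%:R <= c * e / 4.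
  have := ler_wpM2l W0 hN2.

  have -> : W * (c * e / (4 * (W + 1))) = c * e / 4 * (W / (W + 1)).
    by field; rewrite gt_eqF.
  move=> h; apply: le_trans h _.
  by rewrite ler_piMr ?divr_ge0 ?(ltW ce)// ler_pdivrMr// mul1r lerDl.
have -> : error_slow j M delta t k us = us ^+ 2 * Z +
    (t * ((6 * j + 1) * delta) + t * (central (k + k) * (M + C))).
  by rewrite /error_slow /Z; move: (delta^-1) => di; ring.
rewrite -/W; move: e1 e2 hd hk'; clear; lra.
Qed.

Lemma hydrodynamic_limit a b (xi : forall N, conf N) (zeta t : R) :
  0 < a -> 0 < b < 1 -> approximates a b (rhoM j M) xi -> 0 < zeta -> 0 <= t ->
  (fun N => probat j (xi N) (N%:R ^+ 2 * t) (profile_event N zeta)) @ \oo --> 1%E.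
Proof.
move=> a0 b01 approx z0 t0.
have T0 N : 0 <= N%:R ^+ 2 * t by rewrite mulr_ge0// sqr_ge0.
have p1 N := probat_le1 (ltW j_gt0) (xi N) (profile_event N zeta) (T0 N).
have p0 N : (0 <= probat j (xi N) (N%:R ^+ 2 * t)%R (profile_event N zeta))%E.
  by apply: esum_ge0 => eta _; rewrite lee_fin ptrans_ge0// ltW.
have pfin N : probat j (xi N) (N%:R ^+ 2 * t) (profile_event N zeta) \is a fin_num.
  by rewrite ge0_fin_numE// (le_lt_trans (p1 N))// ltry.
apply/fine_cvgP; split; first by near=> N; exact: pfin.
apply/cvgrPdist_le => e e0; near=> N.
have h : ((1 - e)%:E <= probat j (xi N) (N%:R ^+ 2 * t)%R (profile_event N zeta))%E.
  by near: N; exact: (@profile_event_near a b).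
have := p1 N; move: h; rewrite /= -(fineK (pfin N)) !lee_fin => h1 h2.
rewrite ger0_norm ?subr_ge0//; lra.
Unshelve. all: by end_near. Qed.

End HydrodynamicLimit.

(** * Approximating configurations *)

Section Approximants.
Context {R : realType} (j M : R).
Hypotheses (j_gt0 : 0 < j) (M_ge0 : 0 <= M).
Notation C := (plip j M).

Definition ceil_nat (u : R) : nat := `|Num.ceil u|%N.

Lemma ceil_natP (u : R) : 0 <= u -> u <= (ceil_nat u)%:R < u + 1.
Proof.
move=> u0; have c0 : (0 <= Num.ceil u)%R by rewrite ceil_ge0; lra.
have e : (ceil_nat u)%:R = (Num.ceil u)%:~R :> R.
  by rewrite /ceil_nat -[in RHS](gez0_abs c0).
rewrite e; have /andP[h1 h2] := ceil_itv u.
by rewrite h2/= -ltrBlDr; move: h1; rewrite rmorphB.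
Qed.

Lemma ceil_nat_le (u v : R) : 0 <= u -> u <= v -> (ceil_nat u <= ceil_nat v)%N.
Proof.
move=> u0 uv; have /andP[_ h1] := ceil_natP u0.
have /andP[h2 _] := ceil_natP (le_trans u0 uv).
by rewrite -ltnS -(ltr_nat R) -natr1; lra.
Qed.

Lemma ceil_nat_gt0 (u : R) : 0 <= u -> (0 < ceil_nat u)%N = (0 < u).
Proof.
move=> u0; have /andP[h1 h2] := ceil_natP u0; apply/idP/idP => [c0|up].
  by move: c0; rewrite -(ler1n R); lra.
by rewrite -(ltr_nat R); lra.
Qed.

(** Differences of the rounded-up profile: F is then off by less than 1 at every site, so window
    averages err by at most 1/l. Rounding up, rather than down, keeps the support of F and hence the
    edge. *)
Definition ceil_conf N : conf N :=
  [ffun y : 'I_N.+1 => (ceil_nat (pt j M N y) - ceil_nat (pt j M N y.+1))%N].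

Lemma tail_ceil_conf N x : (0 < N)%N -> (x <= N.+1)%N ->
  tail (ceil_conf N) x = (ceil_nat (pt j M N x))%:R :> R.
Proof.
move=> N0; have ceil0 : ceil_nat (pt j M N N.+1) = 0%N.
  by rewrite pt_out// /ceil_nat ceil0.
have [n] := ubnP (N.+1 - x)%N; elim: n x => // n IH x xn xN.
have [xN1|xN1] := eqVneq x N.+1; first by rewrite xN1 tail_out// ceil0.
have xN' : (x <= N)%N by rewrite -ltnS ltn_neqAle xN1.
rewrite tail_rec// IH//; last by lia.
rewrite ffunE inordK// natrB ?subrK// ceil_nat_le ?pt_ge0//.
by have /andP[] := pt_itv M j_gt0 N0 (leqnSn x); rewrite subr_ge0.
Qed.

Lemma discr_ceil_conf N x : (0 < N)%N -> (x <= N.+1)%N ->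
  0 <= discr j M (ceil_conf N) x < 1.
Proof.
move=> N0 xN; rewrite /discr tail_ceil_conf//.
have /andP[h1 h2] := ceil_natP (pt_ge0 M j_gt0 N x).
by rewrite subr_ge0 h1 ltrBlDl.
Qed.

Lemma ceil_conf_window N l x : (0 < N)%N -> (0 < l)%N -> (x + l <= N.+1)%N ->
  `|Ad R l x (ceil_conf N) - Ac l N x (rhoM j M)| <= l%:R^-1.
Proof.
move=> N0 l0 xl; have lp : 0 < l%:R :> R by rewrite ltr0n.
rewrite -(ler_pM2l lp) mulfV ?gt_eqF// -[X in X * _](gtr0_norm lp) -normrM mulrBr.
rewrite Ad_tail// Ac_pt//; last by lia.
have /andP[h1 h2] := @discr_ceil_conf N x N0 (leq_trans (leq_addr l x) xl).
have /andP[h3 h4] := @discr_ceil_conf N (x + l)%N N0 xl.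
move: h1 h2 h3 h4; rewrite /discr ler_norml => *; apply/andP; split; lra.
Qed.

Lemma ceil_conf_edge N : (0 < N)%N ->
  `|(redge (ceil_conf N))%:R / N%:R - pedge j M| <= (N%:R : R)^-1.
Proof.
move=> N0; have Npos : 0 < N%:R :> R by rewrite ltr0n.
have /andP[B0 B1] := pedge_itv M j_gt0.
have tE x : (x <= N.+1)%N -> (0 < tail (ceil_conf N) x :> R) = (x%:R / N%:R < pedge j M).
  move=> xN; rewrite tail_ceil_conf// ltr0n ceil_nat_gt0 ?pt_ge0//.
  by rewrite /pt pmulr_rgt0// ptail_gt0.
have [e|ne] := eqVneq (ceil_conf N) [ffun=> 0%N].
  rewrite (redge_empty e) mul0r sub0r normrN ger0_norm//.
  have := tE 0%N (leq0n _); rewrite e tail_empty ltxx mul0r => /esym/negbT.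
  by rewrite -leNgt => /le_trans; apply; rewrite invr_ge0.
have [rN _] := redge_pos ne.
have := tE _ (leqW rN); rewrite tail_gt0// leqnn => /esym h1.
have := tE (redge (ceil_conf N)).+1 rN; rewrite tail_gt0// ltnn => /esym/negbT.
rewrite -leNgt -natr1 mulrDl mul1r => h2.
rewrite ler_norml; apply/andP; split; lra.
Qed.

Lemma two_le_powR34 N (c : R) : (2 < N)%N -> 3 / 4 <= c -> 2 <= (N%:R : R) `^ c.
Proof.
move=> N3 hc; have N3' : 3 <= N%:R :> R by rewrite ler_nat.
have h34 : 2 <= (3 : R) `^ (3 / 4).
  rewrite -(ler_pXn2r (_ : (0 < 4)%N))// ?nnegrE ?powR_ge0//.
  rewrite -[leRHS]powR_mulrn ?powR_ge0// -powRrM divfK// (powR_mulrn 3)//.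
  by rewrite -!natrX ler_nat.
apply: le_trans h34 _; apply: (@le_trans _ _ ((N%:R : R) `^ (3 / 4))).
  by rewrite ge0_ler_powR ?nnegrE//; lra.
by rewrite ler_powR//; lra.
Qed.

Lemma powR_invE (u c : R) : 0 <= u -> u^-1 `^ c = (u `^ c)^-1.
Proof. by move=> u0; rewrite -powR_inv1// -powRrM mulN1r powRN. Qed.

(** The gap b - a >= 3/4 gives N^b >= 2 N^a for N >= 3, because 3^3 >= 2^4; the factor 2 absorbs the
    integer part. *)
Lemma ell_inv_le (a b : R) N : (2 < N)%N -> 0 < a -> a + 3 / 4 <= b -> b < 1 ->
  (ell b N)%:R^-1 <= (N%:R : R)^-1 `^ a.
Proof.
move=> N3 a0 ab b1; have N0 : 0 < N%:R :> R by rewrite ltr0n; lia.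
have Na0 : 0 < (N%:R : R) `^ a by exact: powR_gt0.
have Na : 1 <= (N%:R : R) `^ a.
  by rewrite -[leLHS](powRr0 (N%:R : R)) ler_powR ?ler1n ?(ltW a0)//; lia.
have h : (N%:R : R) `^ a * 2 <= (N%:R : R) `^ b.
  have -> : b = a + (b - a) by ring.
  rewrite powRD; last by rewrite (gt_eqF N0) implybT.
  by rewrite ler_pM2l// two_le_powR34//; lra.
have /andP[_ t] := truncn_itv (powR_ge0 (N%:R : R) b).
rewrite -/(ell b N) -natr1 in t.
have l0 : (N%:R : R) `^ a <= (ell b N)%:R by lra.
by rewrite powR_invE ?(ltW N0)// lef_pV2// posrE// (lt_le_trans Na0).
Qed.

Lemma inv_le_powR (N : nat) (a : R) : (0 < N)%N -> 0 <= a <= 1 ->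
  (N%:R : R)^-1 <= (N%:R : R)^-1 `^ a.
Proof.
move=> N0 /andP[a0 a1]; have Npos : 0 < N%:R :> R by rewrite ltr0n.
rewrite -[leLHS]powRr1 ?invr_ge0// ger_powR// invr_gt0 Npos/=.
by rewrite invf_le1// ler1n.
Qed.

Lemma half_powR_ge (a : R) : 0 <= a -> 1 - a <= (2%:R : R)^-1 `^ a.
Proof.
move=> a0; rewrite powR_invE// /powR pnatr_eq0/= -expRN.
have ln2 : ln (2%:R : R) <= 1 by have := @le_ln1Dx R 1; rewrite -natr1; apply; lra.
apply: le_trans (expR_ge1Dx _).
by rewrite lerD2l lerN2 ler_piMr.
Qed.

Lemma nearest_nat (u : R) : 0 <= u -> exists v : nat, `|v%:R - u| <= 1 / 2 /\ (1 <= u -> (0 < v)%N).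
Proof.
move=> u0; have u1 : 0 <= u + 1 / 2 by lra.
have /andP[h1 h2] := truncn_itv u1; rewrite -[ltRHS]natr1 in h2.
exists (Num.truncn (u + 1 / 2)); split.
  by rewrite ler_norml; apply/andP; split; lra.
by move=> u2; rewrite truncn_ge_nat//; lra.
Qed.

(* At [N = 2] the windows have length one, so the cumulative rounding of
   [ceil_conf] is too coarse and the two occupation numbers are rounded separately. *)
Lemma approximant2 (a : R) : 0 < a -> a <= 1 / 4 -> a <= j / 8 ->
  exists xi : conf 2,
    (forall x, (x + 1 <= 3)%N ->
      `|Ad R 1 x xi - Ac 1 2 x (rhoM j M)| <= (2%:R : R)^-1 `^ a) /\
    (forall r, is_edge (rhoM j M) r ->
      `|(redge xi)%:R / 2%:R - r| <= (2%:R : R)^-1 `^ a).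
Proof.
move=> a0 a1 a2; set tau := _ `^ a.
have tau1 : 1 - a <= tau by exact/half_powR_ge/ltW.
have N2 : (0 < 2)%N by [].
pose c x := pt j M 2 x - pt j M 2 x.+1.
have c0 x : 0 <= c x by have /andP[] := pt_itv M j_gt0 N2 (leqnSn x).
have AcE x : (x <= 2)%N -> Ac 1 2 x (rhoM j M) = c x.
  by move=> x2; rewrite -[LHS]mul1r (Ac_pt (l := 1) M j_gt0 N2)// addn1.
have AdE (xi : conf 2) x : (x <= 2)%N -> Ad R 1 x xi = (xi (inord x))%:R.
  by move=> x2; rewrite /Ad invr1 mul1r addn1 big_nat1.
have c2 : c 2 = 0 by rewrite /c !pt_out// subrr.
have [v0 [hv0 _]] := nearest_nat (c0 0%N).
pose xi v1 : conf 2 := [ffun i : 'I_3 => if val i == 0%N then v0 else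
  if val i == 1%N then v1 else 0%N].
have xiE v1 x : (x <= 2)%N -> xi v1 (inord x) =
    if x == 0%N then v0 else if x == 1%N then v1 else 0%N.
  by move=> x2; rewrite ffunE/= inordK.
have win v1 : `|v1%:R - c 1%N| <= tau -> forall x, (x + 1 <= 3)%N ->
    `|Ad R 1 x (xi v1) - Ac 1 2 x (rhoM j M)| <= tau.
  move=> hv1 x; rewrite addn1 ltnS => x2; rewrite AdE// AcE// xiE//.
  case: x x2 => [|[|[|]]]//= _; first by apply: le_trans hv0 _; lra.
  by rewrite c2 subrr normr0; lra.
have redge2 v1 : (redge (xi v1) <= 1)%N.
  have [->|ne] := eqVneq (xi v1) [ffun=> 0%N]; first by rewrite (redge_empty (erefl _)).
  have [r2 rp] := redge_pos ne; move: rp; rewrite xiE//.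
  by case: (redge _) r2 => [|[|[|]]].
(* The edge must be matched too. A particle at site 1 puts it at 1/2, within [tau] of any edge; this
   is allowed when [c 1] is at least 1 - tau. Otherwise site 1 is left empty. *)
have [h|h] := leP (1 - tau) (c 1%N).
  have [v1 [hv1 v10]] : exists v1 : nat, `|v1%:R - c 1%N| <= tau /\ (0 < v1)%N.
    have [v [hv vp]] := nearest_nat (c0 1%N).
    have [c1|c1] := leP 1 (c 1%N).
      by exists v; split; [apply: le_trans hv _; lra|exact: vp].
    by exists 1%N; split=> //; rewrite ler_norml; apply/andP; split; lra.
  exists (xi v1); split; first exact: win.
  move=> r /(is_edge_rhoM j_gt0)[_ ->].
  have e : redge (xi v1) = 1%N.
    by apply/eqP; rewrite eqn_leq redge2/= redge_leq// xiE.
  rewrite e; have /andP[B0 B1] := pedge_itv M j_gt0.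
  by rewrite ler_norml; apply/andP; split; lra.
exists (xi 0%N); split.
  by apply: win; have := c0 1%N; rewrite ler_norml => ?; apply/andP; split; lra.
move=> r /(is_edge_rhoM j_gt0)[A0 ->].
have e : redge (xi 0%N) = 0%N.
  have [->|ne] := eqVneq (xi 0%N) [ffun=> 0%N]; first by rewrite (redge_empty (erefl _)).
  have [r2 rp] := redge_pos ne; move: rp; rewrite xiE//.
  by case: (redge _) r2 => [|[|[|]]].
rewrite e mul0r sub0r normrN; have /andP[B0 B1] := pedge_itv M j_gt0.
rewrite ger0_norm// leNgt; apply/negP => tB.
move: h; rewrite ltNge => /negP; apply.
rewrite /c (pt_out M j_gt0 N2 (leqnn 2)) subr0 /pt /ptail A0 mul0r add0r posE; last lra.
(* An edge beyond tau >= 3/4 would give c(1) = 2j d^2 >= j/8 >= a >= 1 - tau: the origin of the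
   bound a <= j/8. *)
have q : 1 / 4 <= pedge j M - 1%:R / 2%:R by lra.
set d := pedge j M - _ in q *.
have q2 : 1 / 16 <= d ^+ 2 by nra.
have := ler_wpM2l (ltW j_gt0) q2; move: tau1 a2; clear; lra.
Qed.

Lemma approximates_exists (a b : R) : 0 < a -> a <= 1 / 5 -> a <= j / 8 ->
  19 / 20 <= b -> b < 1 -> exists xi : forall N, conf N, approximates a b (rhoM j M) xi.
Proof.
move=> a0 a1 a2 b0 b1.
suff H N : exists xi : conf N, (0 < N)%N ->
    (forall x, (x + ell b N <= N.+1)%N ->
      `|Ad R (ell b N) x xi - Ac (ell b N) N x (rhoM j M)| <= (N%:R : R)^-1 `^ a) /\
    (forall r, is_edge (rhoM j M) r ->
      `|(redge xi)%:R / N%:R - r| <= (N%:R : R)^-1 `^ a).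
  exists (fun N => projT1 (cid (H N))) => N N0.
  exact: (projT2 (cid (H N)) N0).
have b01 : 0 < b < 1 by apply/andP; split; lra.
have a01 : 0 <= a <= 1 by apply/andP; split; lra.
have [->|N2] := eqVneq N 2%N.
  (* 2^b < 2, so the window has length one. *)
  have -> : ell b 2 = 1%N :> nat.
    have [l0 l2 _] := ell_itv b01 (isT : (0 < 2)%N).
    apply/eqP; rewrite eqn_leq l0 andbT /ell truncn_le_nat.
    rewrite /powR pnatr_eq0/= -[ltRHS](@lnK _ 2%:R) ?posrE ?ltr0n// ltr_expR.
    by rewrite gtr_pMl// ln_gt0// ltr1n.
  have a4 : a <= 1 / 4 by lra.
  by have [xi h] := approximant2 a0 a4 a2; exists xi.
exists (ceil_conf N) => N0; have [l0 lN _] := ell_itv b01 N0; split.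
- move=> x xl; apply: le_trans (ceil_conf_window N0 l0 xl) _.
  have [N1|N1] := eqVneq N 1%N.
    have -> : N%:R = 1 :> R by rewrite N1.
    by rewrite invr1 powR1 invf_le1 ?ltr0n// ler1n.
  apply: ell_inv_le => //; [lia|lra].
- move=> r /(is_edge_rhoM j_gt0)[_ ->].
  exact: le_trans (ceil_conf_edge N0) (inv_le_powR N0 a01).
Qed.

End Approximants.

(** * Uniqueness *)

Section Uniqueness.
Context {R : realType}.
Notation mu := (@lebesgue_measure R).

Lemma within_continuous_comp (T : topologicalType) (S : set T) (h : T -> R)
    (phi : R -> T) : {within S, continuous h} -> continuous phi ->
  (forall s, S (phi s)) -> continuous (h \o phi).
Proof.
move=> /subspace_continuousP hc phic Sphi s.
have hs := hc (phi s) (Sphi s).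
move=> U /hs wU; apply: (@filterS _ (nbhs s) _ _ _ _ (phic s _ wU)) => r /=; apply.
exact: Sphi.
Qed.

(** Continuity of a limit is known only for r in [0, 1]; composing with the projection gives a
    function continuous on the line. *)
Definition clamp (s : R) : R := Num.max 0 (Num.min s 1).

Lemma clamp_itv s : 0 <= clamp s <= 1.
Proof.
by rewrite /clamp le_max lexx/= ge_max ler01/= ge_min lexx orbT.
Qed.

Lemma clampE s : 0 <= s <= 1 -> clamp s = s.
Proof. by move=> /andP[s0 s1]; rewrite /clamp (min_idPl s1) (max_idPr s0). Qed.

Lemma continuous_clamp : continuous clamp.
Proof.
move=> s; apply: (@continuous_max R R (fun=> 0) (fun s => Num.min s 1)).
  exact: cvg_cst.
by apply: (@continuous_min R R id (fun=> 1)); [exact: cvg_id|exact: cvg_cst].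
Qed.

Lemma Rintegral_ge_cst (g : R -> R) (e p q : R) : continuous g -> p <= q ->
  (forall s, p <= s <= q -> e <= g s) ->
  e * (q - p) <= \int[mu]_(s in `[p, q]) g s.
Proof.
move=> cg pq H.
have -> : e * (q - p) = \int[mu]_(s in `[p, q]) e.
  rewrite Rintegral_cst//= lebesgue_measure_itv/= lte_fin.
  by case: ltgtP pq => // -> _; rewrite subrr.
apply: le_Rintegral => //.
- by apply: continuous_integrable_itv => s; exact: cvg_cst.
- exact: continuous_integrable_itv.
Qed.

Lemma Rintegral_itv_diff (g : R -> R) (p q : R) : continuous g -> p <= q -> q <= 1 ->
  \int[mu]_(s in `[p, q]) g s =
  \int[mu]_(s in `[p, 1]) g s - \int[mu]_(s in `[q, 1]) g s.
Proof.
move=> cg pq q1.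
have := @Rintegral_itvB R g (BLeft p) (BRight 1) q (continuous_integrable_itv p 1 cg).
rewrite !bnd_simp => /(_ pq q1).
rewrite Rintegral_itv_obnd_cbnd.
  by move=> <-; ring.
apply: integrableS (continuous_integrable_itv q 1 cg) => //.
exact: subset_itv_oc_cc.
Qed.

(* A continuous function bounded away from zero near [r0] has a large integral over some
   grid interval, whatever fine grid is used. *)
Lemma eq0_of_small_grid_integrals (g : R -> R) (r0 : R) : continuous g -> 0 <= r0 <= 1 ->
  (forall z : R, 0 < z -> \forall N \near \oo, forall x y : nat, (x <= y <= N)%N ->
     `|\int[mu]_(s in `[x%:R / N%:R, y%:R / N%:R]) g s| <= z) ->
  g r0 = 0.
Proof.
move=> cg /andP[r00 r01] H; apply/eqP/negPn/negP => g0.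
have e0 : 0 < `|g r0| / 2 by rewrite divr_gt0// normr_gt0.
have /cvgrPdist_lt/(_ _ e0) := cg r0.
move=> /nbhs_ballP[d /= d0 gd].
(* L <= 1/4 lets an interval of length L in [0, 1] start or end at [r0]; L < d keeps [g] close to
   [g r0] on it. *)
pose L := Num.min d 1 / 4.
have L0 : 0 < L by rewrite divr_gt0// lt_min d0 ltr01.
have Ld : L < d.
  have : Num.min d 1 <= d by rewrite ge_min lexx.
  rewrite /L; lra.
have L1 : L <= 1 / 4.
  have : Num.min d 1 <= 1 by rewrite ge_min lexx orbT.
  rewrite /L; lra.
have [r1 [r1_0 r1_1 r1r]] : exists r1, [/\ 0 <= r1, r1 + L <= 1 & r1 <= r0 <= r1 + L].
  have [h|h] := leP r0 (1 / 2).
    by exists r0; split; [|lra|apply/andP; split; lra].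
  by exists (r0 - L); split; [lra|lra|apply/andP; split; lra].
have gnear s : r1 <= s <= r1 + L -> `|g r0 - g s| < `|g r0| / 2.
  move=> sr; apply: gd; rewrite /ball/= ltr_norml.
  by move: r1r sr; lra.
have z0 : 0 < `|g r0| / 2 * L / 4 by rewrite divr_gt0// mulr_gt0.
have L4 : 0 < L / 4 by rewrite divr_gt0.
have [n _ Hn] := filterI (H _ z0) (near_invn_le L4).
have {Hn}[Hint [N0 hN]] := Hn n (leqnn n).
have Npos : 0 < n%:R :> R by rewrite ltr0n.
have /andP[x1 x2] := truncn_itv (mulr_ge0 (ltW Npos) r1_0).
have rL : 0 <= r1 + L by lra.
have /andP[y1 y2] := truncn_itv (mulr_ge0 (ltW Npos) rL).
(* The grid interval from [x.+1] to [y] loses at most 1/n at each end, so half of the length L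
   remains. *)
set x := Num.truncn _ in x1 x2; set y := Num.truncn _ in y1 y2.
rewrite -[ltRHS]natr1 in y2.
have px : r1 <= x.+1%:R / n%:R by rewrite ler_pdivlMr// mulrC ltW.
have px' : x.+1%:R / n%:R <= r1 + n%:R^-1.
  rewrite -natr1 mulrDl mul1r lerD2r ler_pdivrMr// mulrC//.
have qy : y%:R / n%:R <= r1 + L by rewrite ler_pdivrMr// mulrC.
have qy' : r1 + L - n%:R^-1 <= y%:R / n%:R.
  have : r1 + L <= (y%:R + 1) / n%:R by rewrite ler_pdivlMr// mulrC ltW.
  by rewrite mulrDl mul1r lerBlDr.
have pq : L / 2 <= y%:R / n%:R - x.+1%:R / n%:R by lra.
have pq0 : x.+1%:R / n%:R <= y%:R / n%:R :> R by lra.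
have xy : (x.+1 <= y <= n)%N.
  apply/andP; split.
    by move: pq0; rewrite ler_pM2r ?invr_gt0// ler_nat.
  by rewrite -(ler_nat R) (le_trans y1)// ler_piMr// ltW.
have := Hint _ _ xy.
set p := x.+1%:R / n%:R in px px' pq pq0 *.
set q := y%:R / n%:R in qy qy' pq pq0 *.
have gs s : p <= s <= q -> `|g r0 - g s| < `|g r0| / 2.
  by move=> /andP[ps sq]; apply: gnear; apply/andP; split; lra.
have [gp|gn] := ltP 0 (g r0).
  rewrite (gtr0_norm gp) in gs z0 e0 *.
  have : g r0 / 2 * (q - p) <= \int[mu]_(s in `[p, q]) g s.
    apply: Rintegral_ge_cst => // s /gs; rewrite ltr_norml => /andP[h1 h2]; lra.
  have : g r0 / 2 * (L / 2) <= g r0 / 2 * (q - p) by rewrite ler_wpM2l// ltW.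
  move=> h1 h2 /(le_trans (ler_norm _)) h3; move: z0 h1 h2 h3; clear; lra.
have gn' : g r0 < 0 by rewrite lt_neqAle g0.
rewrite (ltr0_norm gn') in gs z0 e0 *.
have : - g r0 / 2 * (q - p) <= \int[mu]_(s in `[p, q]) - g s.
  apply: Rintegral_ge_cst => // [s|s /gs]; first by apply: cvgN; exact: cg.
  rewrite ltr_norml => /andP[h1 h2]; lra.
have -> : \int[mu]_(s in `[p, q]) - g s = - \int[mu]_(s in `[p, q]) g s.
  rewrite -mulN1r -RintegralZl//; last exact: continuous_integrable_itv.
  by apply: eq_Rintegral => s _; rewrite mulN1r.
have : - g r0 / 2 * (L / 2) <= - g r0 / 2 * (q - p) by rewrite ler_wpM2l// ltW.
move=> h1 h2 h3; have := le_trans (ler_norm _) (eq_ind_r (fun v => v <= _) h3 (normrN _)).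
move: z0 h1 h2; clear; lra.
Qed.

Lemma near_half_lt (p : nat -> \bar R) : p @ \oo --> 1%E ->
  \forall N \near \oo, ((1 / 2)%:E < p N)%E.
Proof.
move=> /fine_cvgP[pfin cp].
have h : (1 / 2 : R) < 1 by lra.
near=> N.
have finN : p N \is a fin_num by near: N.
by rewrite -(fineK finN) lte_fin; near: N; exact: (@cvgr_gt R _ _ _ (fine \o p) 1 cp (1 / 2) h).
Unshelve. all: by end_near. Qed.

(** Without an approximating family the convergence clause of [hydro_limit] would be vacuous. With
    one, a configuration common to the two events makes the two tail integrals close at every grid
    point, and continuity identifies the densities. *)
Lemma hydro_limit_unique (j M a b : R) (rho : R -> R -> R) :
  0 < j -> 0 <= M -> 0 < a -> 0 < b < 1 ->
  (exists xi : forall N, conf N, approximates a b (rhoM j M) xi) ->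
  hydro_limit j a b (rhoM j M) rho ->
  forall t r, 0 <= t -> 0 <= r <= 1 -> rho t r = rhoM j M r.
Proof.
move=> j0 M0 a0 b01 [xi approx] [rhoc [_ [_ Hlim]]] t r t0 r01.
pose f s := rho t (clamp s).
have cf : continuous f.
  apply: (@within_continuous_comp _ _ _ (fun s => (t, clamp s)) rhoc).
    move=> s /=; apply: (@cvg_pair _ _ _ _ (nbhs t) (nbhs (clamp s)) _ _ _ (fun=> t) clamp).
      exact: cvg_cst.
    exact: continuous_clamp.
  by move=> s /=; split=> //; exact: clamp_itv.
pose g s := f s - pdens_ext j M s.
have cp := continuous_pdens_ext (j := j) (M := M).
have cg : continuous g by move=> s; apply: cvgB; [exact: cf|exact: cp].
have FcE u : 0 <= u -> Fc u (rho t) = \int[mu]_(s in `[u, 1]) f s.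
  move=> u0; apply: eq_Rintegral => s; rewrite inE/= in_itv/= => /andP[us s1].
  by rewrite /f clampE// (le_trans u0).
have FcM u : 0 <= u -> Fc u (rhoM j M) = \int[mu]_(s in `[u, 1]) pdens_ext j M s.
  move=> u0; apply: eq_Rintegral => s; rewrite inE/= in_itv/= => /andP[us s1].
  by rewrite rhoM_pdens_ext// (le_trans u0).
suff : g r = 0.
  by move=> /eqP; rewrite subr_eq0 /f clampE// => /eqP ->; rewrite rhoM_pdens_ext.
apply: eq0_of_small_grid_integrals => // z z0.
have z4 : 0 < z / 4 by rewrite divr_gt0.
have tt : 0 <= t <= t by rewrite t0 lexx.
have L1 := near_half_lt (Hlim xi approx t (z / 4) t z4 tt).
have L2 := near_half_lt (hydrodynamic_limit j0 M0 a0 b01 approx z4 t0).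
have L3 : \forall N \near \oo, (0 < N)%N by exact: nbhs_infty_gt.
apply: filterS (filterI L3 (filterI L1 L2)) => N [N0 [P1 P2]] x y /andP[xy yN].
have Npos : 0 < N%:R :> R by rewrite ltr0n.
have T0 : 0 <= N%:R ^+ 2 * t by rewrite mulr_ge0// sqr_ge0.
set A := [set eta | _] in P1.
have : A `&` profile_event j M (N := N) (z / 4) !=set0.
  apply/set0P/negP => /eqP AB0.
  have := probat_disjoint (ltW j0) (xi N) T0 AB0.
  apply/negP; rewrite -ltNge.
  have -> : (1 = (1 / 2)%:E + (1 / 2)%:E :> \bar R)%E by rewrite -EFinD; congr EFin; lra.
  exact: lteD.
move=> [eta [/= HA HB]].
have near_x u : (u <= N)%N ->
    `|Fc (u%:R / N%:R) (rho t) - Fc (u%:R / N%:R) (rhoM j M)| <= z / 2.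
  move=> uN; have := HA (Ordinal (uN : u < N.+1)%N); have := HB (Ordinal (uN : u < N.+1)%N).
  rewrite /= !ler_norml => /andP[h1 h2] /andP[h3 h4].
  by apply/andP; split; lra.
have u0 (u : nat) : 0 <= u%:R / N%:R :> R by rewrite divr_ge0.
have pq : x%:R / N%:R <= y%:R / N%:R :> R by rewrite ler_pM2r ?invr_gt0// ler_nat.
have q1 : y%:R / N%:R <= 1 :> R by rewrite ler_pdivrMr// mul1r ler_nat.
have := near_x x (leq_trans xy yN); have := near_x y yN.
rewrite !FcE// !FcM//.
rewrite [X in _ -> _ -> `|X| <= _](_ : _ =
  (\int[mu]_(s in `[x%:R / N%:R, 1]) f s - \int[mu]_(s in `[y%:R / N%:R, 1]) f s) -
  (\int[mu]_(s in `[x%:R / N%:R, 1]) pdens_ext j M s -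
   \int[mu]_(s in `[y%:R / N%:R, 1]) pdens_ext j M s)).
  by rewrite !ler_norml => /andP[h1 h2] /andP[h3 h4]; apply/andP; split; lra.
rewrite -!Rintegral_itv_diff// -RintegralB//; exact: continuous_integrable_itv.
Qed.

Lemma rhoM_hydro_limit (j M a b : R) : 0 < j -> 0 <= M -> 0 < a -> 0 < b < 1 ->
  hydro_limit j a b (rhoM j M) (fun _ r => rhoM j M r).
Proof.
move=> j0 M0 a0 b01; split; last split; last split=> //.
- apply: (@subspace_eq_continuous _ _ _ (fun p : R * R => pdens_ext j M p.2)).
    by move=> p; rewrite inE/= => -[_ p2]; exact/esym/(rhoM_pdens_ext M j0 p2).
  apply: continuous_subspaceT => p.
  apply: (@continuous_comp _ _ _ (fun p : R * R => p.2) (pdens_ext j M)).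
    exact: cvg_snd.
  exact: continuous_pdens_ext.
- by move=> t r _; exact: rhoM_ge0.
- move=> xi approx T zeta t z0 /andP[t0 _].
  exact: (hydrodynamic_limit j0 M0 a0 b01 approx z0 t0).
Qed.

End Uniqueness.

(** The hydrodynamic limit is encoded as a predicate, so both halves are proved: the constant
    evolution satisfies it, and any other solution agrees with it. The thresholds do not depend on
    M. *)
Theorem theorem2p7 (R : realType) (j : R) : 0 < j ->
  exists b0 a0 : R, b0 < 1 /\ 0 < a0 /\
  forall b a M : R, b0 < b < 1 -> 0 < a < a0 -> 0 <= M ->
    hydro_limit j a b (rhoM j M) (fun _ r => rhoM j M r) /\
    (forall rho : R -> R -> R, hydro_limit j a b (rhoM j M) rho ->
       forall t r, 0 <= t -> 0 <= r <= 1 -> rho t r = rhoM j M r).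
Proof.
(* 19/20 - 1/5 = 3/4 is the exponent gap used for N >= 3, and j/8 is for N = 2; both serve the
   existence of approximating families. *)
move=> j0; exists (19 / 20), (Num.min (1 / 5) (j / 8)); split; first by lra.
split; first by rewrite lt_min !divr_gt0.
move=> b a M /andP[b0 b1] /andP[a0]; rewrite lt_min => /andP[a1 a2] M0.
have b01 : 0 < b < 1 by apply/andP; split; lra.
split; first exact: rhoM_hydro_limit.
move=> rho; apply: hydro_limit_unique => //.
by apply: approximates_exists => //; exact: ltW.
Qed.
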